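(* Let $(\Phi,\phi)$ be a symmetric couple of types, $F$ an $R$-module of type $\Phi$ with finitely many submodules. Let $\kappa\le\omega\le\phi$ be types such that $(\Phi,\omega)$ is a symmetric couple and such that $\kappa$ satisfies the duality axiom: for a module $x$ of type $\kappa$ and every type $\alpha\le\kappa$, $$|\{y : y\subseteq x,\ \tau(y)=\alpha\}|=|\{y : y\subseteq x,\ \tau(x/y)=\alpha\}|.$$ Then $A_{\omega\kappa}=[\kappa\prec\dot\omega]_{\phi}\cdot[\omega\prec\dot\phi\pitchfork\kappa]_{\Phi}$, where $A$ is the matrix expressing the cellular basis of $\mathcal H_\phi$ in terms of its primitive idempotents, $\mathbf c_\lambda=\sum_{\kappa'\le\lambda}A_{\lambda\kappa'}\mathbf e_{\kappa'}$.
   Context: Let $R$ be a ring; modules are finitely generated left $R$-modules. The type $\tau(x)$ of a module $x$ is its isomorphism class; $\lambda\le\mu$ means that a module of type $\mu$ has a submodule of type $\lambda$. A type $\phi$ is symmetric if for all modules $f,f'$ of type $\phi$, all submodules $x\subseteq f$, $x'\subseteq f'$ and every isomorphism $h:x\to x'$, there is an isomorphism $f\to f'$ extending $h$. For symmetric types $\phi\le\Phi$, $(\Phi,\phi)$ is a symmetric couple if for every module $F$ of type $\Phi$, every $f\subseteq F$ of type $\phi$ and every $\lambda\le\phi$: (i) there is $f'\subseteq F$ with $\tau(f')=\phi$ and $\tau(f\cap f')=\lambda$; (ii) for every $x\subseteq F$ with $\tau(x)\le\phi$, the square formed by $x\cap f$, $x$, $f$, $x+f$ is a pushout, i.e. $x+f\simeq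 (x\oplus f)/(x\cap f)$ (this holds automatically for modules). Let $G=\mathrm{Aut}_R(F)$; $X_\lambda$ is the set of submodules of $F$ of type $\lambda$, $\mathcal F_\lambda$ is the space of $\mathbb Q$-valued functions on $X_\lambda$ with $G$-action $[gf](x)=f(g^{-1}x)$, and $\mathcal H_\phi=\mathrm{End}_G(\mathcal F_\phi)$. For $\lambda\le\phi$ define $\mathbf T_{\phi\succ\lambda}:\mathcal F_\lambda\to\mathcal F_\phi$ by $(\mathbf T_{\phi\succ\lambda}h)(y)=\sum_{x\in X_\lambda,\,x\subseteq y}h(x)$, $\mathbf T_{\lambda\prec\phi}:\mathcal F_\phi\to\mathcal F_\lambda$ by $(\mathbf T_{\lambda\prec\phi}h)(x)=\sum_{y\in X_\phi,\,y\supseteq x}h(y)$, and $\mathbf c_\lambda=\mathbf T_{\phi\succ\lambda}\mathbf T_{\lambda\prec\phi}$; the $\mathbf c_\lambda$ ($\lambda\le\phi$) form the cellular basis of $\mathcal H_\phi$. Put $\mathcal H_\phi^{\lambda}=\mathrm{span}_{\mathbb Q}\{\mathbf c_{\lambda'}:\lambda'\le\lambda\}$, $\mathcal H_\phi^{\lambda^-}=\mathrm{span}_{\mathbb Q}\{\mathbf c_{\lambda'}:\lambda'<\lambda\}$; these are ideals of the commutative semisimple algebra $\mathcal H_\phi$, the quotients $\mathcal K_\lambda=\mathcal H_\phi^{\lambda}/\mathcal H_\phi^{\lambda^-}$ ($\lambda\le\phi$) are one-dimensional and form a complete set of inequivalent irreducible $\mathcal H_\phi$-modules, and $\mathbf e_\lambda$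 denotes the primitive idempotent of $\mathcal H_\phi$ corresponding to $\mathcal K_\lambda$ (acting as $1$ on $\mathcal K_\lambda$ and as $0$ on $\mathcal K_{\lambda'}$ for $\lambda'\ne\lambda$). $[\kappa\prec\dot\omega]_\phi$ is the number of submodules of type $\omega$ which contain a given submodule of type $\kappa$ and are contained in a given module of type $\phi$. $[\omega\prec\dot\phi\pitchfork\kappa]_\Phi$ is the number of submodules of $F$ of type $\phi$ which contain $x_\omega$ and intersect $x_\kappa$ trivially, where $x_\omega,x_\kappa\subseteq F$ are submodules of types $\omega,\kappa$ with $x_\omega\cap x_\kappa=0$. (Both numbers are independent of the choices.) *)

(* Defs.v *)
From HB Require Import structures.
From mathcomp Require Import all_boot all_order all_algebra.
From mathcomp Require Import finmap.
From mathcomp Require Import boolp classical_sets functions cardinality fsbigop.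
From mathcomp Require Import generic_quotient ring_quotient.

Set Implicit Arguments.
Unset Strict Implicit.
Unset Printing Implicit Defensive.

Import GRing.Theory.

Local Open Scope classical_set_scope.
Local Open Scope ring_scope.
Local Open Scope quotient_scope.

Definition span (K : pzRingType) (V : lmodType K) (S : set V) : set V :=
  [set u | exists (n : nat) (v : 'I_n -> V) (a : 'I_n -> K),
     (forall i, S (v i)) /\ u = \sum_(i < n) a i *: v i].

Definition fin_generated (R : pzRingType) (M : lmodType R) : Prop :=
  exists S : set M, finite_set S /\ span S = [set: M].

(* The carrier is a boolean predicate so that submodules are extensional
   and inherit a module structure from the library's subtype factories; [{pred M}] would add universe
   constraints incompatible with MathComp-Analysis. *)
Record submodule (R : pzRingType) (M : lmodType R) := Submodule {
  smpred : M -> bool;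
  smpredP : submod_closed smpred }.

HB.instance Definition _ (R : pzRingType) (M : lmodType R) :=
  gen_eqMixin (submodule M).
HB.instance Definition _ (R : pzRingType) (M : lmodType R) :=
  gen_choiceMixin (submodule M).

HB.instance Definition _ (R : pzRingType) (M : lmodType R) (N : submodule M) :=
  GRing.isSubmodClosed.Build R M (smpred N)
    (GRing.submod_closed_semi (smpredP N)).

Section SubmoduleAsModule.
Variables (R : pzRingType) (M : lmodType R) (N : submodule M).

Definition submodule_sort := {x : M | x \in smpred N}.

HB.instance Definition _ := SubChoice.on submodule_sort.
HB.instance Definition _ :=
  [SubChoice_isSubLmodule of submodule_sort by <:].

Definition submodule_lmod : lmodType R := submodule_sort.

End SubmoduleAsModule.

Coercion submodule_lmod : submodule >-> GRing.Lmodule.type.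

(* The library only provides quotients of Z-modules by closed predicates. *)
Section QuotientModule.
Variables (R : pzRingType) (M : lmodType R) (N : submodule M).

Definition quotmod :=
  Quotient.quot (GRing.ZmodClosed.clone M (smpred N) _).

HB.instance Definition _ := GRing.Zmodule.on quotmod.
HB.instance Definition _ := ZmodQuotient.on quotmod.

Definition quotmod_scale (a : R) (x : quotmod) : quotmod :=
  \pi_quotmod (a *: repr x).

Lemma quotmod_scale_pi a x :
  quotmod_scale a (\pi_quotmod x) = \pi_quotmod (a *: x).
Proof.
apply/eqP; rewrite /quotmod_scale -[_ == _]Quotient.idealrBE -scalerBr.
apply: rpredZ; rewrite Quotient.idealrBE; apply/eqP.
exact: reprK.
Qed.

Fact quotmod_scalerA a b x :
  quotmod_scale a (quotmod_scale b x) = quotmod_scale (a * b) x.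
Proof.
by rewrite -[x]reprK (quotmod_scale_pi b) (quotmod_scale_pi a) scalerA
           (quotmod_scale_pi (a * b)).
Qed.

Fact quotmod_scale1r : left_id 1 quotmod_scale.
Proof. by move=> x; rewrite -[x]reprK quotmod_scale_pi scale1r. Qed.

Fact quotmod_scalerDr : right_distributive quotmod_scale +%R.
Proof.
move=> a x y; rewrite -[x]reprK -[y]reprK -raddfD !quotmod_scale_pi.
by rewrite -raddfD scalerDr.
Qed.

Fact quotmod_scalerDl x : {morph quotmod_scale^~ x : a b / a + b}.
Proof.
by move=> a b /=; rewrite -[x]reprK !quotmod_scale_pi -raddfD scalerDl.
Qed.

HB.instance Definition _ := GRing.Zmodule_isLmodule.Build R quotmod
  quotmod_scalerA quotmod_scale1r quotmod_scalerDr quotmod_scalerDl.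

End QuotientModule.

Section Types.
Variable R : pzRingType.
Implicit Types M N : lmodType R.

Definition isomorphic M N : Prop := exists f : {linear M -> N}, bijective f.

Lemma isomorphic_refl M : isomorphic M M.
Proof. by exists idfun; exists idfun. Qed.

Lemma isomorphic_sym M N : isomorphic M N -> isomorphic N M.
Proof.
move=> [f [g fK gK]].
have g_lin : linear g.
  by move=> a u v; apply: (can_inj fK); rewrite linearP !gK.
pose gL := GRing.isLinear.Build R N M *:%R g g_lin.
pose g' : {linear N -> M} := HB.pack g gL.
by exists g'; exists f.
Qed.

Lemma isomorphic_trans L M N :
  isomorphic L M -> isomorphic M N -> isomorphic L N.
Proof.
move=> [f fb] [g gb]; exists (g \o f : {linear L -> N}).
exact: bij_comp.
Qed.

(* An isomorphism class of modules.  It lives in a universe above that of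
   the carriers, hence a plain predicate and no [choiceType] instance. *)
Record mod_type := ModType {
  type_class : lmodType R -> Prop;
  type_classP : exists M, type_class = isomorphic M }.

Definition typ M : mod_type :=
  ModType (ex_intro _ M (erefl (isomorphic M))).

Lemma typP M N : typ M = typ N <-> isomorphic M N.
Proof.
split=> [/(congr1 (fun t => type_class t N)) /= ->|MN].
  exact: isomorphic_refl.
suff E : isomorphic M = isomorphic N.
  rewrite /typ; move: (ex_intro _ M _) (ex_intro _ N _).
  by rewrite E => p q; congr ModType; exact: Prop_irrelevance.
apply/funext => L; apply/propext; split; last exact: isomorphic_trans.
exact/isomorphic_trans/isomorphic_sym.
Qed.

Definition tle (l m : mod_type) : Prop :=
  exists M (N : submodule M), typ M = m /\ typ N = l.

Definition tlt (l m : mod_type) : Prop := tle l m /\ l <> m.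

End Types.

Section Submodules.
Variables (R : pzRingType) (M : lmodType R).
Implicit Types x y : submodule M.

Definition smle x y : Prop := {subset smpred x <= smpred y}.

Fact smcap_closed x y :
  submod_closed [pred a | (a \in smpred x) && (a \in smpred y)].
Proof.
split=> [|a u v /andP[ux uy] /andP[vx vy]]; first by rewrite !inE !rpred0.
by rewrite !inE !rpredD ?rpredZ.
Qed.
Definition smcap x y := Submodule (smcap_closed x y).

Fact smadd_closed x y :
  submod_closed [pred c : M | `[< exists a b : M,
    [/\ a \in smpred x, b \in smpred y & c = a + b] >]].
Proof.
split=> [|a u v].
  rewrite inE; exists 0, 0.
  by split; rewrite ?rpred0 ?addr0.
rewrite !inE => -[u1 [u2 [u1x u2y ->]]] [v1 [v2 [v1x v2y ->]]].
exists (a *: u1 + v1), (a *: u2 + v2).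
by split; rewrite ?rpredD ?rpredZ // scalerDr addrACA.
Qed.
Definition smadd x y := Submodule (smadd_closed x y).

Definition trivial_meet x y : Prop :=
  forall a, a \in smpred x -> a \in smpred y -> a = 0.

(* [w] restricts to [u] on [x] and to [v] on [y]. *)
Definition is_pushout_map x y (N : lmodType R)
    (u : {linear x -> N}) (v : {linear y -> N})
    (w : {linear smadd x y -> N}) : Prop :=
  (forall (a : x) (s : smadd x y), val s = val a -> w s = u a) /\
  (forall (b : y) (s : smadd x y), val s = val b -> w s = v b).

(* The square of inclusions x :&: y, x, y, x + y is a pushout of modules. *)
Definition pushout_square x y : Prop :=
  forall (N : lmodType R) (u : {linear x -> N}) (v : {linear y -> N}),
    (forall (c : smcap x y) (a : x) (b : y),
       val a = val c -> val b = val c -> u a = v b) ->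
    exists w : {linear smadd x y -> N}, is_pushout_map u v w /\
      forall w' : {linear smadd x y -> N}, is_pushout_map u v w' -> w' =1 w.

End Submodules.

Section SymmetricCouples.
Variable R : pzRingType.
Implicit Types l t : mod_type R.

Definition symmetric_type t : Prop :=
  forall (f f' : lmodType R), typ f = t -> typ f' = t ->
  forall (x : submodule f) (x' : submodule f') (h : {linear x -> x'}),
    bijective h ->
    exists2 g : {linear f -> f'}, bijective g &
      forall a : x, g (val a) = val (h a).

Definition symmetric_couple (Phi phi : mod_type R) : Prop :=
  [/\ symmetric_type Phi, symmetric_type phi, tle phi Phi &
   forall (F : lmodType R) (f : submodule F) l,
     typ F = Phi -> typ f = phi -> tle l phi ->
     (exists f' : submodule F, typ f' = phi /\ typ (smcap f f') = l) /\
     (forall x : submodule F, tle (typ x) phi -> pushout_square x f)].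

Definition duality_axiom (k : mod_type R) : Prop :=
  forall (x : lmodType R) (a : mod_type R), typ x = k -> tle a k ->
    ([set y : submodule x | typ y = a] #=
     [set y : submodule x | typ (quotmod y) = a])%card.

End SymmetricCouples.

Section Hecke.
Variables (R : pzRingType) (F : lmodType R).
Implicit Types l k phi : mod_type R.

Definition same_typ (x y : submodule F) : bool := `[< typ x = typ y >].

Fact same_typ_equiv : equiv_class_of same_typ.
Proof.
split=> [x|x y|y x z]; first exact/asboolP.
  by apply/asboolP/asboolP.
by move=> /asboolP xy /asboolP yz; apply/asboolP; rewrite xy.
Qed.
Canonical same_typ_rel := EquivRelPack same_typ_equiv.
Canonical same_typ_encModRel := defaultEncModRel same_typ.

(* The isomorphism classes of submodules of [F]: a small, hence summable,
   copy of the set of types [<= typ F]. *)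
Definition sub_type := {eq_quot same_typ}.
HB.instance Definition _ := Choice.on sub_type.
Definition type_of (k : sub_type) : mod_type R := typ (repr k).

Definition subs l := {x : submodule F | `[< typ x = l >]}.

Definition fspace l : lmodType rat := subs l -> rat^o.

Record automorphism := Automorphism {
  aut_fun :> {linear F -> F};
  aut_bij : bijective aut_fun }.

Fact smpreim_closed (g : {linear F -> F}) (x : submodule F) :
  submod_closed [pred a | g a \in smpred x].
Proof.
split=> [|a u v]; rewrite !inE ?linear0 ?rpred0 // => ux vx.
by rewrite linearP rpredD ?rpredZ.
Qed.
Definition smpreim g x := Submodule (smpreim_closed g x).

Lemma typ_smpreim (g : automorphism) (x : submodule F) :
  typ (smpreim g x) = typ x.
Proof.
apply/typP; have [h gK hK] := aut_bij g.
have f_sub (a : smpreim g x) : g (val a) \in smpred x by exact: (valP a).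
pose f (a : smpreim g x) : x := Sub (g (val a)) (f_sub a).
have f_lin : linear f.
  by move=> c u v; apply/val_inj; rewrite /= !linearP.
have k_sub (b : x) : h (val b) \in smpred (smpreim g x).
  by rewrite inE hK; exact: (valP b).
pose k (b : x) : smpreim g x := Sub (h (val b)) (k_sub b).
pose fL := GRing.isLinear.Build R (smpreim g x) x *:%R f f_lin.
pose f' : {linear smpreim g x -> x} := HB.pack f fL.
by exists f'; exists k => a; apply/val_inj => /=.
Qed.

Fact subs_preim_subproof l (g : automorphism) (x : subs l) :
  `[< typ (smpreim g (val x)) = l >].
Proof. by rewrite typ_smpreim; exact: (valP x). Qed.

(* g^-1 x, as the preimage of [x] under [g]. *)
Definition subs_preim l (g : automorphism) (x : subs l) : subs l :=
  Sub (smpreim g (val x)) (subs_preim_subproof g x).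

Definition act l (g : automorphism) (h : fspace l) : fspace l :=
  fun x => h (subs_preim g x).

(* Sums over classical sets are 0 when the support is infinite; the operators
   and counts below are meant for [F] with finitely many submodules. *)
Definition T_succ phi l (h : fspace l) : fspace phi :=
  fun y => \sum_(x \in [set x : subs l | smle (val x) (val y)]) h x.

Definition T_prec l phi (h : fspace phi) : fspace l :=
  fun x => \sum_(y \in [set y : subs phi | smle (val x) (val y)]) h y.

Definition operator phi : lmodType rat := fspace phi -> fspace phi.

Definition hecke phi : set (operator phi) :=
  [set T | linear T /\ forall g h, T (act g h) = act g (T h)].

Definition cell phi l : operator phi := @T_succ phi l \o @T_prec l phi.
Arguments cell : clear implicits.

Definition hecke_le phi l : set (operator phi) :=
  span [set T | exists2 l', tle l' l & T = cell phi l'].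
Arguments hecke_le : clear implicits.

Definition hecke_lt phi l : set (operator phi) :=
  span [set T | exists2 l', tlt l' l & T = cell phi l'].
Arguments hecke_lt : clear implicits.

Definition primitive_idempotent phi (e : operator phi) : Prop :=
  [/\ hecke e, e \o e = e, e <> 0 &
   forall a b : operator phi, hecke a -> hecke b ->
     a \o a = a -> b \o b = b -> a \o b = 0 -> b \o a = 0 -> e = a + b ->
     a = 0 \/ b = 0].

(* The action on the quotient [hecke_le phi l / hecke_lt phi l] is written
   out on representatives. *)
Definition cell_idempotent phi l (e : operator phi) : Prop :=
  [/\ primitive_idempotent e,
   forall a, hecke_le phi l a -> hecke_lt phi l (e \o a - a) &
   forall l', tle l' phi -> l' <> l ->
     forall a, hecke_le phi l' a -> hecke_lt phi l' (e \o a)].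

Definition cell_expansion phi (e : mod_type R -> operator phi)
    (A : mod_type R -> mod_type R -> rat) : Prop :=
  forall l, tle l phi ->
    cell phi l =
      \sum_(k \in [set k : sub_type | tle (type_of k) l])
        A l (type_of k) *: e (type_of k).

Definition nb_transverse (phi : mod_type R) (xo xk : submodule F) : nat :=
  #|` fset_set [set y : submodule F |
        [/\ typ y = phi, smle xo y & trivial_meet y xk]] |.

Definition nb_above (om : mod_type R) (x : submodule F) : nat :=
  #|` fset_set [set z : submodule F | typ z = om /\ smle x z] |.

End Hecke.

Arguments cell {R F} phi l.
Arguments hecke_le {R F} phi l.
Arguments hecke_lt {R F} phi l.

(* Main.v *)
Require Import Defs.
From HB Require Import structures.
From mathcomp Require Import all_boot all_order all_algebra finmap.
From mathcomp Require Import boolp classical_sets functions cardinality fsbigop.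
From mathcomp Require Import generic_quotient ring_quotient.

(** The coefficient [A omega kappa] is the scalar by which [c_omega] acts on
    the one-dimensional quotient of the cellular filtration at [kappa]: since
    [e_l o c_kappa] is [c_kappa] for [l = kappa], and [0] otherwise, modulo
    lower terms, composing the expansion of [c_omega] with [c_kappa] gives
      [c_omega o c_kappa = A omega kappa *: c_kappa + lower terms]
    ([expansion_comp]).  So [c_omega o c_kappa] is computed directly.

    Its kernel counts, for [z] of type [omega] and [x] of type [kappa], the
    submodules of type [phi] containing [z + x].  As [x] embeds in the module
    [z] of symmetric type, the inclusion of [x :&: z] in [z] extends to [x], so
    that [z + x] is isomorphic to [z (+) x / (x :&: z)] ([typ_smadd]); since
    the type of [F] is symmetric, the count is a function [nb_join w x] of the
    pair formed by [w = x :&: z] and [x].  Moebius inversion on the submodules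
    of [F] writes it as the sum over [w <= x :&: z] of a transform [nu w x].
    After exchanging sums, the symmetry of [phi] makes all the remaining counts
    depend on the type of [w] only, and [c_omega o c_kappa] becomes a
    combination of the [c_alpha] for [alpha <= kappa] ([cell_comp]).  For
    [alpha = kappa] only [w = x] contributes, with coefficient the number of
    submodules of type [omega] between [x] and a module of type [phi], times
    [nu x x].

    It remains to see that [nu x x], the sum over [w <= x] of
    [mu(w, x) nb_join w x], is the number of submodules of type [phi] that
    contain [x_omega] and meet [x] trivially.  Inclusion-exclusion writes the
    latter as the sum over [v <= x] of [mu(0, v)] times the number of
    submodules of type [phi] containing [x_omega (+) v].  The term of [w] in
    the first sum depends only on the type of [x / w], in the way the term of
    [v] in the second one depends on the type of [v], because the interval
    [[w, x]] is isomorphic to [[0, x / w]] ([mu_quotient]); duality says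
    that the quotients and the submodules of [x] have the same types with the
    same multiplicities ([nu_transverse]).

    The comparison of the two expressions of [c_omega o c_kappa] needs that
    [c_kappa] is not a combination of lower terms.  Otherwise [e_kappa] would
    lower every layer of the filtration, and being idempotent it would
    annihilate them all, in particular the identity [c_phi]
    ([cell_notin_lt]). *)

Local Open Scope classical_set_scope.
Local Open Scope ring_scope.

Set Implicit Arguments.
Unset Strict Implicit.
Unset Printing Implicit Defensive.

Import GRing.Theory.

(** * Linear maps, submodules and types *)

Section Modules.
Variable R : pzRingType.
Implicit Types M N K : lmodType R.

(** The linear map with underlying function [f]. *)
Definition lin_of M N (f : M -> N) (fl : linear f) : {linear M -> N} :=
  HB.pack_for {linear M -> N} f (GRing.isLinear.Build R M N *:%R f fl).

Lemma lin_ofE M N (f : M -> N) (fl : linear f) : lin_of fl =1 f.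
Proof. by []. Qed.

Lemma inj_surj_bijective (T U : Type) (f : T -> U) :
  injective f -> (forall y, exists x, f x = y) -> bijective f.
Proof.
move=> fI fS; pose g y := sval (cid (fS y)).
have gK y : f (g y) = y by rewrite /g; case: cid.
by exists g => // x; apply: fI; rewrite gK.
Qed.

Lemma bij_surj (T U : Type) (f : T -> U) :
  bijective f -> forall y, exists x, f x = y.
Proof. by move=> [g _ gK] y; exists (g y). Qed.

Lemma linear_inv M N (f : {linear M -> N}) : bijective f ->
  exists g : {linear N -> M}, cancel f g /\ cancel g f.
Proof.
move=> [g fK gK].
have gl : linear g by move=> a u v; apply: (can_inj fK); rewrite linearP !gK.
by exists (lin_of gl).
Qed.

Lemma submodP M (x y : submodule M) :
  (forall a, (a \in smpred x) = (a \in smpred y)) -> x = y.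
Proof.
case: x y => [p pP] [q qP] /= pq.
have E : p = q by apply/funext => a; exact: pq.
by rewrite E in pP *; congr Submodule; exact: Prop_irrelevance.
Qed.

Lemma smle_trans M (y x z : submodule M) : smle x y -> smle y z -> smle x z.
Proof. by move=> xy yz a /xy /yz. Qed.

Lemma smle_anti M (x y : submodule M) : smle x y -> smle y x -> x = y.
Proof. by move=> xy yx; apply: submodP => a; apply/idP/idP => [/xy|/yx]. Qed.

(** The zero submodule. *)
Fact sm0_closed M : submod_closed [pred a : M | a == 0].
Proof.
split=> [|a u v]; first by rewrite inE.
by rewrite !inE => /eqP -> /eqP ->; rewrite scaler0 addr0.
Qed.
Definition sm0 M := Submodule (sm0_closed M).

Lemma in_sm0 M (a : M) : (a \in smpred (sm0 M)) = (a == 0).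
Proof. by []. Qed.

Lemma sm0_le M (x : submodule M) : smle (sm0 M) x.
Proof. by move=> a; rewrite in_sm0 => /eqP ->; rewrite rpred0. Qed.

(** [i] embeds [K] in [M] with image [u]. *)
Definition param K M (i : {linear K -> M}) (u : submodule M) : Prop :=
  injective i /\ forall a, a \in smpred u <-> exists k, i k = a.

(** The image under [i] of a submodule of [K]. *)
Fact smimage_closed K M (i : {linear K -> M}) (x : submodule K) :
  submod_closed [pred a : M | `[< exists2 k, k \in smpred x & i k = a >]].
Proof.
split=> [|a u v]; rewrite !inE.
  by exists 0; rewrite ?rpred0 ?linear0.
move=> [k kx <-] [l lx <-].
by exists (a *: k + l); rewrite ?linearP// rpredD ?rpredZ.
Qed.
Definition smimage K M (i : {linear K -> M}) (x : submodule K) :=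
  Submodule (smimage_closed i x).

Lemma in_smimage K M (i : {linear K -> M}) (x : submodule K) a :
  a \in smpred (smimage i x) <-> exists2 k, k \in smpred x & i k = a.
Proof. exact: iff_sym (rwP (asboolP _)). Qed.

Lemma param_typ K M (i : {linear K -> M}) u : param i u -> typ u = typ K.
Proof.
move=> [iI iu]; apply/esym/typP.
have iP k : i k \in smpred u by apply/iu; exists k.
pose g (k : K) : u := Sub (i k) (iP k).
have gl : linear g by move=> a k l; apply: val_inj; rewrite /= linearP.
exists (lin_of gl); apply: inj_surj_bijective => [k l /(congr1 val)/= /iI //|y].
have /iu[k kE] := valP y.
by exists k; apply: val_inj.
Qed.

Lemma typ_param K M (u : submodule M) : typ K = typ u ->
  exists i : {linear K -> M}, param i u.
Proof.
move=> /typP[f fb].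
have jl : linear (fun k => val (f k)) by move=> a k l; rewrite linearP.
exists (lin_of jl); split => [k l /val_inj /(bij_inj fb) //|a]; split.
  move=> au; have [k kE] := bij_surj fb (Sub a au : u).
  by exists k; rewrite /= kE.
by move=> [k <-]; exact: (valP (f k)).
Qed.

Lemma smimage_param K M (i : {linear K -> M}) (x : submodule K) :
  injective i -> typ (smimage i x) = typ x.
Proof.
move=> iI.
have jl : linear (fun k : x => i (val k)) by move=> a k l; rewrite !linearP.
apply: (@param_typ _ _ (lin_of jl)); split => [k l /iI/val_inj //|a].
rewrite in_smimage; split => [[k kx <-]|[k <-]].
  by exists (Sub k kx : x).
by exists (val k) => //; exact: valP.
Qed.

(** The intersection of [x] and [w], as a submodule of the module [x]. *)
Fact restr_closed M (x w : submodule M) :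
  submod_closed [pred a : x | val a \in smpred w].
Proof.
split=> [|a u v]; rewrite !inE ?linear0 ?rpred0// => uw vw.
by rewrite linearP rpredD ?rpredZ.
Qed.
Definition restr M (x w : submodule M) : submodule x :=
  Submodule (restr_closed x w).

Lemma in_restr M (x w : submodule M) (a : x) :
  (a \in smpred (restr x w)) = (val a \in smpred w).
Proof. by []. Qed.

(** The inclusion of a submodule. *)
Definition sminc M (x : submodule M) : {linear x -> M} :=
  lin_of (fun (a : R) (u v : x) => linearP (val : {linear x -> M}) a u v).

Lemma sminc_param M (x : submodule M) : param (sminc x) x.
Proof.
split=> [a b /val_inj //|a]; split=> [ax|[k <-]]; last exact: valP.
by exists (Sub a ax : x).
Qed.

Lemma smincl M (w x : submodule M) : smle w x ->
  exists i : {linear w -> x}, forall a, val (i a) = val a.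
Proof.
move=> wx.
have l : linear (fun a : w => Sub (val a) (wx _ (valP a)) : x).
  by move=> a u v; apply: val_inj.
by exists (lin_of l).
Qed.

Lemma smimage_le K M (i : {linear K -> M}) u (x : submodule K) :
  param i u -> smle (smimage i x) u.
Proof. by move=> [_ iu] a /in_smimage[k _ <-]; apply/iu; exists k. Qed.

Lemma smimage_mono K M (i : {linear K -> M}) (x y : submodule K) :
  injective i -> smle (smimage i x) (smimage i y) <-> smle x y.
Proof.
move=> iI; split=> xy a.
  move=> ax; have /xy/in_smimage[b bx /iI <-//] : i a \in smpred (smimage i x).
  by apply/in_smimage; exists a.
by move=> /in_smimage[k kx <-]; apply/in_smimage; exists k => //; exact: xy.
Qed.


(** The preimage under [i] of a submodule of [M]. *)
Fact smpre_closed K M (i : {linear K -> M}) (x : submodule M) :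
  submod_closed [pred a | i a \in smpred x].
Proof.
split=> [|a u v]; rewrite !inE ?linear0 ?rpred0 // => ux vx.
by rewrite linearP rpredD ?rpredZ.
Qed.
Definition smpre K M (i : {linear K -> M}) (x : submodule M) :=
  Submodule (smpre_closed i x).

Lemma in_smpre K M (i : {linear K -> M}) (x : submodule M) a :
  (a \in smpred (smpre i x)) = (i a \in smpred x).
Proof. by []. Qed.

Lemma smimageK K M (i : {linear K -> M}) u v : param i u -> smle v u ->
  smimage i (smpre i v) = v.
Proof.
move=> [iI iu] vu; apply: submodP => a; apply/idP/idP.
  by move/in_smimage => [k]; rewrite in_smpre => kv <-.
move=> av; have /iu[k kE] := vu _ av.
by apply/in_smimage; exists k => //; rewrite in_smpre kE.
Qed.

Lemma smpreK K M (i : {linear K -> M}) x : injective i ->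
  smpre i (smimage i x) = x.
Proof.
move=> iI; apply: submodP => a; rewrite in_smpre; apply/idP/idP.
  by move/in_smimage => [k kx /iI <-].
by move=> ax; apply/in_smimage; exists a.
Qed.

Lemma smimage_inj K M (i : {linear K -> M}) : injective i ->
  injective (smimage i).
Proof. by move=> iI x y E; rewrite -(smpreK x iI) E smpreK. Qed.

Lemma quotmod_pi_linear M (W : submodule M) :
  linear (fun a : M => \pi_(quotmod W)%qT a).
Proof.
move=> a u v; rewrite raddfD; congr (_ + _).
exact: esym (quotmod_scale_pi _ _ _).
Qed.

(** First isomorphism theorem. *)
Lemma quotmod_iso M N (W : submodule M) (p : {linear M -> N}) :
  (forall b, exists a, p a = b) -> (forall a, (p a == 0) = (a \in smpred W)) ->
  typ (quotmod W) = typ N.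
Proof.
move=> pS pW; apply/typP.
(* The isomorphism is [p] on representatives. *)
have pR a : p (repr (\pi_(quotmod W) a)%qT) = p a.
  apply/eqP; rewrite -subr_eq0 -linearB pW Quotient.idealrBE.
  by apply/eqP; rewrite reprK.
have fl : linear (fun q : quotmod W => p (repr q)).
  move=> a u v; rewrite -[u in LHS]reprK -[v in LHS]reprK.
  by rewrite -quotmod_pi_linear pR linearP.
exists (lin_of fl); apply: inj_surj_bijective => [u v|b].
  rewrite !lin_ofE => E; rewrite -[u]reprK -[v]reprK; apply/eqP.
  by rewrite -[_ == _]Quotient.idealrBE -pW linearB subr_eq0 E.
by have [a <-] := pS b; exists (\pi_(quotmod W)%qT a); rewrite lin_ofE pR.
Qed.

Lemma quotmod_pi_eq0 M (W : submodule M) (a : M) :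
  (\pi_(quotmod W)%qT a == 0) = (a \in smpred W).
Proof.
rewrite -[a in RHS]subr0 Quotient.idealrBE.
suff -> : (0 : quotmod W) = \pi_(quotmod W)%qT (0 : M) by [].
by rewrite raddf0.
Qed.

Lemma quotmod_pi M (W : submodule M) : exists p : {linear M -> quotmod W},
  (forall b, exists a, p a = b) /\ (forall a, (p a == 0) = (a \in smpred W)).
Proof.
exists (lin_of (@quotmod_pi_linear _ W)); split=> [b|a].
  by exists (repr b); rewrite lin_ofE reprK.
exact: quotmod_pi_eq0.
Qed.

(** [tle] is stated for some pair of modules; over any module of the larger
    type it is realized by a submodule. *)
Lemma typ_tle M (l : mod_type R) : tle l (typ M) ->
  exists N : submodule M, typ N = l.
Proof.
move=> [M' [N [/typP ME <-]]]; have [f /bij_inj fI] := ME.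
by exists (smimage f N); rewrite smimage_param.
Qed.

Lemma tle_typ M (x : submodule M) : tle (typ x) (typ M).
Proof. by exists M, x. Qed.

Lemma smle_tle M (x y : submodule M) : smle x y -> tle (typ x) (typ y).
Proof.
move=> xy; have -> : typ x = typ (restr y x); last exact: tle_typ.
have [i iE] := smincl xy; apply/esym/(@param_typ _ _ i); split.
  by move=> a b E; apply: val_inj; rewrite -!iE E.
move=> a; rewrite in_restr; split => [ax|[k <-]].
  by exists (Sub (val a) ax); apply: val_inj; rewrite iE.
by rewrite iE; exact: valP.
Qed.

Lemma tle_sub M (y : submodule M) l : tle l (typ y) ->
  exists2 x : submodule M, smle x y & typ x = l.
Proof.
move=> /typ_tle[N NE]; exists (smimage (sminc y) N).
  exact: smimage_le (sminc_param y).
by rewrite smimage_param //; case: (sminc_param y).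
Qed.


Lemma mod_typeE (l : mod_type R) : exists M, l = typ M.
Proof.
case: l => C P; have [M E] := P; exists M; rewrite /typ.
by move: (ex_intro _ M _) => Q; subst C; congr ModType; exact: Prop_irrelevance.
Qed.

(** The full submodule. *)
Fact smT_closed M : submod_closed [pred a : M | true].
Proof. by []. Qed.
Definition smT M := Submodule (smT_closed M).

Lemma typ_smT M : typ (smT M) = typ M.
Proof.
by apply: (@param_typ _ _ idfun); split => // a; split => // _; exists a.
Qed.

Lemma tle_refl (l : mod_type R) : tle l l.
Proof. by have [M ->] := mod_typeE l; rewrite -{1}typ_smT; exact: tle_typ. Qed.

Lemma tle_trans (m l n : mod_type R) : tle l m -> tle m n -> tle l n.
Proof.
move=> lm [M [N [<- mE]]]; rewrite -mE in lm.
by have [x _ <-] := tle_sub lm; exact: tle_typ.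
Qed.

(** Over a symmetric type, two embeddings of the same module differ by an
    isomorphism of the ambient modules. *)
Lemma symmetric_extend (t : mod_type R) (M M' K : lmodType R)
    (i : {linear K -> M}) (i' : {linear K -> M'}) :
  symmetric_type t -> typ M = t -> typ M' = t -> injective i -> injective i' ->
  exists2 g : {linear M -> M'}, bijective g & forall k, g (i k) = i' k.
Proof.
move=> tS Mt M't iI i'I.
have im (N : lmodType R) (j : {linear K -> N}) : injective j ->
    exists2 j' : {linear K -> smimage j (smT K)}, bijective j' &
      forall k, val (j' k) = j k.
  move=> jI; have jP k : j k \in smpred (smimage j (smT K)).
    by apply/in_smimage; exists k.
  have jl : linear (fun k => Sub (j k) (jP k) : smimage j (smT K)).
    by move=> a k l; apply: val_inj; rewrite /= linearP.
  exists (lin_of jl) => //; apply: inj_surj_bijective => [k l [] /jI //|a].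
  have /in_smimage[k _ kE] := valP a.
  by exists k; apply: val_inj.
have [j jb jE] := im _ _ iI; have [j' j'b j'E] := im _ _ i'I.
have [h [jK hK]] := linear_inv jb.
have hb : bijective (j' \o h : {linear _ -> _}).
  by apply: bij_comp => //; exists j.
have [g gb gE] := tS _ _ Mt M't _ _ _ hb.
by exists g => // k; rewrite -jE gE /= jK j'E.
Qed.

End Modules.

(** * Moebius functions *)

Lemma bigD1_seq_cond (T : eqType) (V : nmodType) (s : seq T) (P : pred T)
    (F : T -> V) (c : T) : uniq s -> c \in s -> P c ->
  \sum_(i <- s | P i) F i = F c + \sum_(i <- s | P i && (i != c)) F i.
Proof.
move=> su cs Pc; rewrite -big_filter.
rewrite (bigD1_seq c) ?mem_filter ?Pc ?filter_uniq//=.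
by rewrite big_filter_cond.
Qed.

Section Moebius.
Variables (T : eqType) (s : seq T) (le : rel T).
Hypotheses (s_uniq : uniq s) (s_all : forall x, x \in s).
Hypotheses (le_refl : reflexive le) (le_anti : antisymmetric le)
  (le_trans : transitive le).

(* Number of elements below [c]: the measure of all inductions on the order. *)
Let rank c := count (le^~ c) s.

Lemma rank_lt b c : le b c -> b != c -> (rank b < rank c)%N.
Proof.
move=> bc nbc; rewrite /rank.
have -> : count (le^~ c) s = (count (fun d => le d b) s +
    count (fun d => le d c && ~~ le d b) s)%N.
  rewrite -!sum1_count (bigID (le^~ b)) /=; congr addn; apply: eq_bigl => d.
  by case: (boolP (le d b)) => db; rewrite ?andbF// (le_trans db bc).
rewrite -[X in (X < _)%N]addn0 ltn_add2l -has_count; apply/hasP; exists c => //.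
rewrite le_refl /=; apply: contra nbc => cb.
by apply/eqP/le_anti; rewrite bc cb.
Qed.

(* The fuel [n] is irrelevant once it exceeds the rank of [c]. *)
Fixpoint moebius_rec n a c : rat :=
  if n is n'.+1 then
    if a == c then 1 else
    - \sum_(b <- s | [&& le a b, le b c & b != c]) moebius_rec n' a b
  else 0.

(** The Moebius function of the finite poset [s], by recursion on the upper
    end; it vanishes on the pairs [(a, c)] such that [a <= c] fails. *)
Definition moebius a c := moebius_rec (size s).+1 a c.

Lemma moebius_rec_stable n m a c : (rank c < n)%N -> (rank c < m)%N ->
  moebius_rec n a c = moebius_rec m a c.
Proof.
elim: n m c => [//|n IH] [//|m] c /= cn cm; case: eqP => // _; congr (- _).
apply: eq_bigr => b /and3P[_ bc nbc]; have lt := rank_lt bc nbc.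
by apply: IH; apply: leq_trans lt _.
Qed.

Lemma moebiusE a c : moebius a c = if a == c then 1 else
  - \sum_(b <- s | [&& le a b, le b c & b != c]) moebius a b.
Proof.
rewrite /moebius [in LHS]/=; case: eqP => // _; congr (- _).
apply: eq_bigr => b /and3P[_ bc nbc]; apply: moebius_rec_stable.
  by apply: leq_trans (rank_lt bc nbc) _; exact: count_size.
by rewrite ltnS count_size.
Qed.

Lemma moebius_out a c : ~~ le a c -> moebius a c = 0.
Proof.
move=> nac; rewrite moebiusE; case: eqP => [ac|_].
  by rewrite ac le_refl in nac.
rewrite big1 ?oppr0// => b /and3P[ab bc _].
by rewrite (le_trans ab bc) in nac.
Qed.

Lemma moebius_suml a c :
  \sum_(b <- s | le b c) moebius a b = (a == c)%:R.
Proof.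
rewrite (@bigD1_seq_cond _ _ s _ _ c) ?s_all//= moebiusE; case: eqP => [->|nac].
  rewrite big1 ?addr0// => b /andP[bc nbc]; apply: moebius_out.
  by apply: contra nbc => cb; apply/eqP/le_anti; rewrite bc cb.
apply/eqP; rewrite addrC subr_eq0; apply/eqP.
rewrite [LHS](bigID (le a)) /= [X in _ + X]big1 ?addr0.
  by apply: eq_bigl => b; rewrite andbC.
by move=> b /andP[_ /moebius_out].
Qed.

(** The Moebius function is invariant under an isomorphism [f] from the
    interval [[a0, c0]] to [[f a0, f c0]]. *)
Lemma moebius_isotone (f : T -> T) a0 c0 :
  (forall b d, le a0 b -> le b c0 -> le a0 d -> le d c0 ->
     le (f b) (f d) = le b d) ->
  (forall d, le (f a0) d -> le d (f c0) ->
     exists b, [/\ le a0 b, le b c0 & f b = d]) ->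
  forall c, le a0 c -> le c c0 -> moebius (f a0) (f c) = moebius a0 c.
Proof.
move=> fM fS c; have [n] := ubnP (rank c); elim: n c => [//|n IH] c cn ac cc.
have a0c0 := le_trans ac cc.
have fI b d : le a0 b -> le b c0 -> le a0 d -> le d c0 -> f b = f d -> b = d.
  move=> b1 b2 d1 d2 E; apply/le_anti.
  by rewrite -fM// -[le d b]fM// E le_refl.
rewrite !moebiusE; have -> : (f a0 == f c) = (a0 == c).
  by apply/eqP/eqP => [|->//]; exact: fI.
case: eqP => // nac; congr (- _).
pose Q := [pred b | [&& le a0 b, le b c & b != c]].
have QP b : Q b -> le a0 b /\ le b c0.
  by move=> /and3P[-> bc _]; split=> //; exact: le_trans bc cc.
have E : perm_eq [seq b <- s | [&& le (f a0) b, le b (f c) & b != f c]]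
                 (map f [seq b <- s | Q b]).
  apply: uniq_perm; rewrite ?filter_uniq//.
    rewrite map_inj_in_uniq ?filter_uniq// => b d; rewrite !mem_filter.
    by move=> /andP[/QP[? ?] _] /andP[/QP[? ?] _]; exact: fI.
  move=> d; rewrite mem_filter s_all andbT; apply/and3P/mapP.
    move=> [ad dc ndc]; have [|b [ab bc fb]] := fS d ad.
      by apply: le_trans dc _; rewrite fM.
    exists b => //; rewrite mem_filter s_all /= ab andbT -fM// fb dc /=.
    by apply: contra ndc => /eqP <-; rewrite fb.
  move=> [b]; rewrite mem_filter s_all andbT => Qb ->; have [ab bc0] := QP _ Qb.
  move: Qb => /and3P[_ bc nbc].
  rewrite !fM// ab bc; split=> //; apply: contra nbc => /eqP fbc.
  by apply/eqP; exact: fI.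
rewrite -big_filter (perm_big _ E) big_map big_filter.
apply: eq_bigr => b Qb; have [? ?] := QP _ Qb; apply: IH => //.
by move: Qb => /and3P[_ bc nbc]; exact: leq_trans (rank_lt bc nbc) _.
Qed.

End Moebius.

(** * Enumeration of submodules *)

Section Enumeration.
Variable R : pzRingType.
Implicit Types M K : lmodType R.

(** The list of all submodules of [M]; it is meaningful when there are finitely
    many of them. *)
Definition smenum M : seq (submodule M) :=
  enum_fset (fset_set [set: submodule M]).

Lemma smenum_uniq M : uniq (smenum M).
Proof. exact: fset_uniq. Qed.

Lemma mem_smenum M : finite_set [set: submodule M] ->
  forall x, x \in smenum M.
Proof. by move=> fin x; rewrite /smenum in_fset_set ?inE. Qed.

Lemma finite_submodule_param M K (i : {linear K -> M}) : injective i ->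
  finite_set [set: submodule M] -> finite_set [set: submodule K].
Proof.
move=> iI fin; have := @finite_preimage _ _ [set: submodule M] (smimage i).
by rewrite preimage_setT; apply=> // x y _ _; exact: smimage_inj.
Qed.

(** Inclusion of submodules as a boolean relation. *)
Definition smleb M (x y : submodule M) : bool := `[< smle x y >].

Lemma smlebP M (x y : submodule M) : reflect (smle x y) (smleb x y).
Proof. exact: asboolP. Qed.

Lemma smleb_refl M : reflexive (@smleb M).
Proof. by move=> x; apply/smlebP. Qed.

Lemma smleb_anti M : antisymmetric (@smleb M).
Proof. by move=> x y /andP[/smlebP ? /smlebP ?]; exact: smle_anti. Qed.

Lemma smleb_trans M : transitive (@smleb M).
Proof.
by move=> y x z /smlebP xy /smlebP yz; apply/smlebP; exact: smle_trans yz.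
Qed.

Lemma perm_smimage M K (i : {linear K -> M}) u : param i u ->
  finite_set [set: submodule M] -> finite_set [set: submodule K] ->
  perm_eq (map (smimage i) (smenum K)) [seq v <- smenum M | smleb v u].
Proof.
move=> iu fin fin'; have [iI _] := iu.
apply: uniq_perm; rewrite ?filter_uniq ?smenum_uniq//.
  by rewrite map_inj_uniq ?smenum_uniq//; exact: smimage_inj.
move=> v; rewrite mem_filter mem_smenum ?andbT//; apply/mapP/smlebP.
  by move=> [x _ ->]; exact: smimage_le.
by move=> vu; exists (smpre i v); rewrite ?mem_smenum// (smimageK iu).
Qed.

Lemma card_fset_set_count M (P : set (submodule M)) :
  finite_set [set: submodule M] ->
  #|` fset_set P | = count (fun x => `[< P x >]) (smenum M).
Proof.
move=> fin; rewrite -size_filter; apply: perm_size; apply: uniq_perm.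
- exact: fset_uniq.
- by rewrite filter_uniq ?smenum_uniq.
move=> x; rewrite mem_filter mem_smenum// andbT in_fset_set ?inE//.
exact: sub_finite_set fin.
Qed.

End Enumeration.

(** * Sums of submodules *)

Section Sums.
Variable R : pzRingType.
Implicit Types M N : lmodType R.

Lemma in_smadd M (x y : submodule M) a :
  a \in smpred (smadd x y) <-> exists b c,
    [/\ b \in smpred x, c \in smpred y & a = b + c].
Proof. exact: iff_sym (rwP (asboolP _)). Qed.

Lemma smadd_le M (x y u : submodule M) :
  smle (smadd x y) u <-> smle x u /\ smle y u.
Proof.
split=> [xyu|[xu yu] a /in_smadd[b [c [bx cy ->]]]].
  by split=> a au; apply: xyu; apply/in_smadd; [exists a, 0|exists 0, a];
    split; rewrite ?rpred0 ?addr0 ?add0r.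
exact: rpredD (xu _ bx) (yu _ cy).
Qed.

Lemma typ_prod M M' N N' : typ M = typ M' -> typ N = typ N' ->
  typ (M * N)%type = typ (M' * N')%type.
Proof.
move=> /typP[f fb] /typP[g gb]; apply/typP.
have hl : linear (fun p : M * N => (f p.1, g p.2)).
  by move=> a u v /=; rewrite !linearP.
exists (lin_of hl); apply: inj_surj_bijective => [[a b] [c d] []|[a b]].
  by move=> /(bij_inj fb) -> /(bij_inj gb) ->.
have [c <-] := bij_surj fb a; have [d <-] := bij_surj gb b.
by exists (c, d).
Qed.

Lemma typ_smadd_direct M (x y : submodule M) : trivial_meet x y ->
  typ (smadd x y) = typ (x * y)%type.
Proof.
move=> xy0.
have l : linear (fun p : x * y => val p.1 + val p.2).
  by move=> a [u u'] [v v'] /=; rewrite scalerDr addrACA.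
apply: (@param_typ _ _ _ (lin_of l)); split=> [[a b] [c d] /=|a].
  move=> E.
  have ac : val (a - c) = val (d - b).
    by rewrite /=; apply/eqP; rewrite subr_eq addrAC [val d + _]addrC -E addrK.
  have /eqP: val (a - c) = 0.
    by apply: xy0; [exact: valP|rewrite ac; exact: valP].
  have /eqP: val (d - b) = 0.
    by rewrite -ac; apply: xy0; [exact: valP|rewrite ac; exact: valP].
  by rewrite !subr_eq0 => /eqP/val_inj -> /eqP/val_inj ->.
split=> [/in_smadd[b [c [bx cy ->]]]|[[b c] <-]]; last apply/in_smadd.
  by exists (Sub b bx : x, Sub c cy : y).
by exists (val b), (val c); split => //; exact: valP.
Qed.

(** If [x] embeds in [z], and [z] is of symmetric type, then the inclusion of
    [x :&: z] in [z] extends to [s : x -> z]; subtracting [s] shows that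
    [x + z] is the direct sum of [z] and a copy of [x / (x :&: z)]. *)
Lemma typ_smadd M (z x : submodule M) : symmetric_type (typ z) ->
  tle (typ x) (typ z) ->
  typ (smadd z x) = typ (z * quotmod (restr x z))%type.
Proof.
move=> zS /typ_tle[N /esym/typ_param[j [jI _]]].
pose W := restr x z.
pose i : {linear W -> z} := j \o sminc W.
have iI : injective i by move=> a b /jI /val_inj.
have i'l : linear (fun a : W => Sub (val (val a)) (valP a) : z).
  by move=> a u v; apply: val_inj.
have i'I : injective (lin_of i'l).
  by move=> a b /(congr1 val) E; apply/val_inj/val_inj; exact: E.
have [g _ gE] := symmetric_extend zS erefl erefl iI i'I.
have sE (b : x) : b \in smpred W -> val (g (j b)) = val b.
  by move=> bW; have := gE (Sub b bW : W) => /= ->.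
(* The map [b |-> b - s b] has kernel [x :&: z]. *)
have [d dE] : exists d : {linear x -> M}, forall b, d b = val b - val (g (j b)).
  have dl : linear (fun b : x => val b - val (g (j b)) : M).
    by move=> a u v; rewrite !linearP /= scalerBr scalerN addrACA.
  by exists (lin_of dl).
have dW b : b \in smpred W -> d b = 0 by move=> bW; rewrite dE sE ?subrr.
have dR b : d (repr (\pi_(quotmod W)%qT b)) = d b.
  apply/eqP; rewrite -subr_eq0 -linearB; apply/eqP/dW.
  by rewrite Quotient.idealrBE; apply/eqP; rewrite reprK.
have fl : linear (fun p : z * quotmod W => val p.1 + d (repr p.2)).
  move=> a [u p] [v q] /=; rewrite -[p in LHS]reprK -[q in LHS]reprK.
  by rewrite -quotmod_pi_linear dR !linearP /= scalerDr addrACA.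
apply: (@param_typ _ _ _ (lin_of fl)); split=> [|a].
  apply: raddf_inj => -[u q] /=; rewrite -[q]reprK dR dE => E.
  have qz : repr q \in smpred W.
    rewrite in_restr -[val _](subrK (val (g (j (repr q))))).
    apply: rpredD; last exact: valP.
    by rewrite -[_ - _](addKr (val u)) E addr0 rpredN; exact: valP.
  move: E; rewrite sE// subrr addr0 => u0; congr pair; first exact: val_inj.
  by rewrite -[LHS]reprK; apply/eqP; rewrite quotmod_pi_eq0 reprK.
split=> [/in_smadd[b [c [bz cx ->]]]|[[u q] <-]]; last apply/in_smadd.
  exists ((Sub b bz : z) + g (j (Sub c cx)), \pi_(quotmod W)%qT (Sub c cx : x)).
  rewrite -[LHS]/(b + val (g (j (Sub c cx))) + d (repr (\pi_(quotmod W)%qT _))).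
  by rewrite dR dE /= [c - _]addrC addrA addrK.
exists (val u - val (g (j (repr q)))), (val (repr q)); split=> /=.
- by apply: rpredB; exact: valP.
- exact: valP.
by rewrite dE addrCA addrC.
Qed.


End Sums.

(** * Automorphisms of a module of symmetric type *)

Section Automorphisms.
Variables (R : pzRingType) (F : lmodType R).
Hypothesis F_fin : finite_set [set: submodule F].
Implicit Types (u v w x y z : submodule F).

Let s := smenum F.

Lemma smimage_bij_perm (g : {linear F -> F}) : bijective g ->
  perm_eq (map (smimage g) s) s.
Proof.
move=> /[dup] /bij_inj gI /bij_surj gS.
have gT : param g (smT F) by split=> // a; split => // _; exact: gS.
apply: uniq_perm; rewrite ?smenum_uniq//.
  by rewrite map_inj_uniq ?smenum_uniq//; exact: smimage_inj.
move=> v; rewrite mem_smenum//; apply/mapP; exists (smpre g v).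
  exact: mem_smenum.
by rewrite (smimageK gT).
Qed.

Lemma sum_smimage (g : {linear F -> F}) (P : pred (submodule F))
    (f : submodule F -> rat) : bijective g ->
  \sum_(x <- s | P x) f x = \sum_(x <- s | P (smimage g x)) f (smimage g x).
Proof.
by move=> gb; rewrite -(perm_big _ (smimage_bij_perm gb)) big_map.
Qed.

Lemma smleb_smimage (g : {linear F -> F}) x y : injective g ->
  smleb (smimage g x) (smimage g y) = smleb x y.
Proof. by move=> gI; apply/smlebP/smlebP; rewrite smimage_mono. Qed.

(** The Moebius function of the lattice of submodules of [F]. *)
Definition mu := moebius s (@smleb R F).

Lemma mu_smimage (g : {linear F -> F}) w x : bijective g -> smle w x ->
  mu (smimage g w) (smimage g x) = mu w x.
Proof.
move=> /[dup] /bij_inj gI /bij_surj gS wx.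
have gT : param g (smT F) by split=> // a; split => // _; exact: gS.
apply: (@moebius_isotone _ _ _ _ _ _ _ _ _ w x);
  rewrite ?smenum_uniq//; try exact/smlebP.
- exact: mem_smenum.
- exact: smleb_refl.
- exact: smleb_anti.
- exact: smleb_trans.
- by move=> *; exact: smleb_smimage.
move=> d wd dx; exists (smpre g d); split; last exact: smimageK gT _.
- by rewrite -(smleb_smimage _ _ gI) (smimageK gT).
- by rewrite -(smleb_smimage _ _ gI) (smimageK gT).
Qed.

(** The intervals [[0, v]] and [[w, x]] are isomorphic when [v] is isomorphic
    to [x / w]. *)
Lemma mu_quotient w x v : smle w x ->
  typ (quotmod (restr x w)) = typ v -> mu w x = mu (sm0 F) v.
Proof.
move=> wx /typP[h hb]; have [p0 [p0S p0K]] := quotmod_pi (restr x w).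
pose p : {linear x -> v} := h \o p0.
have pS b : exists a, p a = b.
  by have [c <-] := bij_surj hb b; have [a <-] := p0S c; exists a.
have pK a : (p a == 0) = (val a \in smpred w).
  by rewrite -in_restr -p0K /= -(inj_eq (bij_inj hb)) linear0.
(* The preimage by [p : x -> v], an isomorphism of [[0, v]] onto [[w, x]]. *)
pose f b := smimage (sminc x) (smpre p (restr v b)).
have inf b (a : x) : val a \in smpred (f b) <-> val (p a) \in smpred b.
  split=> [/in_smimage[k kb /val_inj <-] //|pb].
  by apply/in_smimage; exists a.
have f_le b : smle (f b) x by exact: smimage_le (sminc_param x).
have f0 : f (sm0 F) = w.
  apply: submodP => a; apply/idP/idP => [af|aw].
    move: (f_le _ _ af) => ax; move: af; rewrite (_ : a = val (Sub a ax : x))//.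
    by move=> /inf; rewrite in_sm0 => /eqP pa0; rewrite -pK; apply/eqP/val_inj.
  have ax := wx _ aw; have /eqP pa0 : p (Sub a ax) == 0 by rewrite pK.
  by rewrite (_ : a = val (Sub a ax : x))//; apply/inf; rewrite in_sm0 pa0.
have fv : f v = x.
  apply: smle_anti => // a ax.
  rewrite (_ : a = val (Sub a ax : x))//; apply/inf.
  exact: valP.
have fM b d : smle b v -> smleb (f b) (f d) = smleb b d.
  move=> bv; apply/smlebP/smlebP => bd a.
    move=> ab; have [c ca] := pS (Sub a (bv _ ab)).
    by have /bd/inf : val c \in smpred (f b); [apply/inf|]; rewrite ca.
  move=> /[dup]/f_le ax; rewrite (_ : a = val (Sub a ax : x))//.
  by move=> /inf/bd/inf.
rewrite -[in LHS]f0 -[in LHS]fv.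
apply: (@moebius_isotone _ _ _ _ _ _ _ _ _ (sm0 F) v);
  rewrite ?smenum_uniq//; try by apply/smlebP; try exact: sm0_le.
- exact: mem_smenum.
- exact: smleb_refl.
- exact: smleb_anti.
- exact: smleb_trans.
- by move=> b d _ /smlebP bv _ _; exact: fM.
move=> d; rewrite f0 fv => /smlebP wd /smlebP dx.
pose b := smimage (sminc v) (smimage p (restr x d)).
exists b; split; first by apply/smlebP; exact: sm0_le.
  by apply/smlebP; exact: smimage_le (sminc_param v).
apply: smle_anti => a.
  move=> /[dup]/f_le ax; rewrite (_ : a = val (Sub a ax : x))// => /inf.
  move=> /in_smimage[k /in_smimage[c cd <-] /val_inj E].
  rewrite -[Sub a ax](subrK c) raddfD/=; apply: rpredD => //.
  apply: wd; rewrite -[_ - _]/(val (Sub a ax - c)) -pK.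
  by rewrite linearB E subrr.
move=> ad; rewrite (_ : a = val (Sub a (dx _ ad) : x))//; apply/inf.
apply/in_smimage; exists (p (Sub a (dx _ ad))) => //.
by apply/in_smimage; exists (Sub a (dx _ ad)).
Qed.

Lemma typ_quotient_smimage (g : {linear F -> F}) w x : bijective g ->
  typ (quotmod (restr (smimage g x) (smimage g w))) = typ (quotmod (restr x w)).
Proof.
move=> /bij_inj gI.
have [p [pS pK]] := quotmod_pi (restr (smimage g x) (smimage g w)).
have gP (a : x) : g (val a) \in smpred (smimage g x).
  by apply/in_smimage; exists (val a) => //; exact: valP.
have gl : linear (fun a : x => Sub (g (val a)) (gP a) : smimage g x).
  by move=> a u v; apply: val_inj; rewrite /= !linearP.
apply/esym/(@quotmod_iso _ _ _ _ (p \o lin_of gl)) => [b|a].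
  have [c <-] := pS b; have /in_smimage[k kx kE] := valP c.
  exists (Sub k kx : x); rewrite (_ : c = lin_of gl (Sub k kx))//.
  by apply: val_inj; rewrite -kE.
rewrite [LHS]pK !in_restr; apply/idP/idP => [/in_smimage[k kw /gI <-]//|aw].
by apply/in_smimage; exists (val a).
Qed.

Hypothesis F_sym : symmetric_type (typ F).

Lemma automorphism_move u v : typ u = typ v ->
  exists2 g : {linear F -> F}, bijective g & smimage g u = v.
Proof.
move=> /typ_param[i [iI iv]].
have [uI _] := sminc_param u.
have [g gb gE] := symmetric_extend F_sym erefl erefl uI iI.
exists g => //; apply: submodP => a; apply/idP/idP.
  move=> /in_smimage[k ku <-]; apply/iv; exists (Sub k ku).
  by rewrite -gE.
move=> /iv[k <-]; rewrite -gE; apply/in_smimage; exists (val k) => //.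
exact: valP.
Qed.

Lemma automorphism_move2 w y w' y' : smle w y -> smle w' y' ->
  typ w = typ w' -> typ y = typ y' -> symmetric_type (typ y) ->
  exists g : {linear F -> F},
    [/\ bijective g, smimage g w = w' & smimage g y = y'].
Proof.
move=> wy w'y' /typP[h hb] yy' yS.
have [i iE] := smincl wy; have [i' i'E] := smincl w'y'.
have iI : injective i by move=> a b /(congr1 val); rewrite !iE => /val_inj.
have i'I : injective (i' \o h : {linear w -> y'}).
  by move=> a b /(congr1 val); rewrite /= !i'E => /val_inj /(bij_inj hb).
have [g1 g1b g1E] := symmetric_extend yS erefl (esym yy') iI i'I.
have [yI _] := sminc_param y.
have y'I : injective (sminc y' \o g1 : {linear y -> F}).
  by move=> a b /val_inj /(bij_inj g1b).
have [g gb gE] := symmetric_extend F_sym erefl erefl yI y'I.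
exists g; split=> //; apply: submodP => a; apply/idP/idP.
- move=> /in_smimage[k kw <-].
  have := gE (i (Sub k kw)); rewrite /= g1E /= i'E iE /= => ->; exact: valP.
- move=> aw'; have [k kE] := bij_surj hb (Sub a aw').
  apply/in_smimage; exists (val k); first exact: valP.
  by have := gE (i k); rewrite /= g1E /= i'E iE kE.
- move=> /in_smimage[k ky <-].
  by have := gE (Sub k ky) => /= ->; exact: valP.
move=> ay'; have [k kE] := bij_surj g1b (Sub a ay').
apply/in_smimage; exists (val k); first exact: valP.
by have := gE k; rewrite /= kE.
Qed.

(** A submodule has as many submodules as its image by an automorphism, hence
    is not isomorphic to a proper submodule of itself. *)
Lemma typ_le_eq x y : smle x y -> typ x = typ y -> x = y.
Proof.
move=> xy /automorphism_move[g gb gx]; apply: contrapT => /eqP nxy.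
have := rank_lt (mem_smenum F_fin) (@smleb_refl _ _) (@smleb_anti _ _)
  (@smleb_trans _ _) (introT (smlebP _ _) xy) nxy.
suff -> : count (fun d => smleb d y) (smenum F) =
          count (fun d => smleb d x) (smenum F) by rewrite ltnn.
have /permP/(_ (fun d => smleb d y)) <- := smimage_bij_perm gb.
rewrite count_map; apply: eq_count => d /=.
by rewrite -gx smleb_smimage //; exact: bij_inj.
Qed.

End Automorphisms.

(** * The duality axiom *)

Section Duality.
Variables (R : pzRingType) (x : lmodType R).
Hypotheses (x_fin : finite_set [set: submodule x])
  (x_dual : duality_axiom (typ x)).

Let W := smenum x.

Lemma duality_count a : tle a (typ x) ->
  count (fun w => `[< typ (quotmod w) = a >]) W =
  count (fun v : submodule x => `[< typ v = a >]) W.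
Proof.
move=> ax; have := x_dual erefl ax.
set A := [set y : submodule x | typ y = a].
set B := [set y : submodule x | typ (quotmod y) = a] => AB.
have [n An] : finite_set A by exact: sub_finite_set x_fin.
have Bn : (B #= `I_n)%card by rewrite -(card_eql AB).
have := card_fset_set An; have := card_fset_set Bn.
by rewrite !card_fset_set_count// => -> ->.
Qed.

(* Types do not form an [eqType]: a type is represented by a canonical submodule
   of [x] of this type, when there is one. *)
Let rep (t : mod_type R) : submodule x :=
  xget (sm0 x) [set v : submodule x | typ v = t].

Let repP t : (exists v : submodule x, typ v = t) -> typ (rep t) = t.
Proof. by move=> [v vt]; rewrite /rep; case: xgetP => [r _ //|/(_ v)]. Qed.

Let good (w : submodule x) :=
  `[< exists v : submodule x, typ v = typ (quotmod w) >].

Let perm_rep : perm_eq [seq rep (typ (v : submodule x)) | v <- W]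
  [seq rep (typ (quotmod w)) | w <- W & good w].
Proof.
apply/allP => r _ /=; apply/eqP; rewrite !count_map count_filter.
have repE (v : submodule x) : typ (rep (typ v)) = typ v.
  by apply: repP; exists v.
have [rr|nrr] := eqVneq (rep (typ r)) r.
  transitivity (count (fun v : submodule x => `[< typ v = typ r >]) W).
    apply: eq_count => v /=; apply/eqP/asboolP => [<-|->//].
    by rewrite repE.
  rewrite -duality_count; last exact: tle_typ.
  apply: eq_count => w /=.
  apply/asboolP/andP => [wr|[/eqP <- /asboolP/repP ->//]].
  by rewrite wr rr eqxx; split=> //; apply/asboolP; exists r.
have count0 (p : pred (submodule x)) : (forall w, ~ p w) -> count p W = 0%N.
  move=> p0; rewrite -(count_pred0 W); apply: eq_count => w.
  exact/negbTE/negP.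
rewrite !count0// => w /=.
  move=> /andP[/eqP wr /asboolP/repP wE]; move/negP: nrr; apply.
  by rewrite -{1}wr wE wr.
move=> /eqP vr; move/negP: nrr; apply.
by rewrite -{1}vr repE vr.
Qed.

(** Every quotient of [x] is isomorphic to a submodule of [x]: by duality the
    quotients with this property are as many as the submodules of [x], hence as
    many as all the quotients. *)
Lemma duality_sub_quot (w : submodule x) :
  exists v : submodule x, typ v = typ (quotmod w).
Proof.
have := perm_size perm_rep; rewrite !size_map size_filter => /esym/eqP.
by rewrite -all_count => /allP/(_ w (mem_smenum x_fin w))/asboolP.
Qed.

Lemma duality_sum (theta : mod_type R -> rat) :
  \sum_(w <- W) theta (typ (quotmod w)) =
  \sum_(v <- W) theta (typ (v : submodule x)).
Proof.
have E : [seq w <- W | good w] = W.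
  by apply/all_filterP/allP => w _; apply/asboolP; exact: duality_sub_quot.
have PE := perm_rep; rewrite E in PE.
transitivity (\sum_(v <- [seq rep (typ (quotmod w)) | w <- W])
    theta (typ (v : submodule x))).
  rewrite big_map; apply: eq_bigr => w _.
  by rewrite repP//; exact: duality_sub_quot.
rewrite -(perm_big _ PE) big_map; apply: eq_bigr => v _.
by rewrite repP//; exists v.
Qed.

End Duality.

(** * Counting submodules of type phi *)

Section Counting.
Variables (R : pzRingType) (F : lmodType R).
Hypothesis F_fin : finite_set [set: submodule F].
Hypothesis F_sym : symmetric_type (typ F).
Implicit Types (u v w x y z : submodule F).

Let s := smenum F.
Let mem_s x : x \in s. Proof. exact: mem_smenum. Qed.

(** The boolean test that [u] has type [t]. *)
Definition has_typ (t : mod_type R) u : bool := `[< typ u = t >].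

Lemma has_typP t u : reflect (typ u = t) (has_typ t u).
Proof. exact: asboolP. Qed.

Lemma has_typ_smimage (g : {linear F -> F}) t u : injective g ->
  has_typ t (smimage g u) = has_typ t u.
Proof. by move=> gI; rewrite /has_typ smimage_param. Qed.

Lemma mu0_typ v v' : typ v = typ v' -> mu (sm0 F) v = mu (sm0 F) v'.
Proof.
move=> /(automorphism_move F_sym)[g gb <-].
have g0 : smimage g (sm0 F) = sm0 F.
  apply: smle_anti => [a /in_smimage[k]|]; last exact: sm0_le.
  by rewrite !in_sm0 => /eqP -> <-; rewrite linear0.
by rewrite -[in RHS]g0 mu_smimage//; exact: sm0_le.
Qed.

Lemma mu_out w x : ~~ smleb w x -> mu w x = 0.
Proof.
by apply: moebius_out => //;
  first [exact: smenum_uniq|exact: smleb_refl|exact: smleb_anti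
        |exact: smleb_trans].
Qed.

Lemma mu_suml w x : \sum_(u <- s | smleb u x) mu w u = (w == x)%:R.
Proof.
by apply: moebius_suml => //;
  first [exact: smenum_uniq|exact: smleb_refl|exact: smleb_anti
        |exact: smleb_trans].
Qed.

Lemma trivial_meetP x y : trivial_meet x y <-> sm0 F = smcap x y.
Proof.
split=> [xy|E a ax ay].
  apply: smle_anti => [|a /andP[ax ay]]; first exact: sm0_le.
  by rewrite in_sm0 (xy a).
have : a \in smpred (smcap x y) by apply/andP.
by rewrite -E in_sm0 => /eqP.
Qed.

Lemma smleb_cap u x y : smleb u (smcap x y) = smleb u x && smleb u y.
Proof.
apply/smlebP/andP => [uxy|[/smlebP ux /smlebP uy] a au].
  by split; apply/smlebP => a /uxy /andP[].
by apply/andP; split; [exact: ux|exact: uy].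
Qed.

Lemma smleb_add u x y : smleb (smadd x y) u = smleb x u && smleb y u.
Proof.
apply/smlebP/andP => [/smadd_le[? ?]|[/smlebP ? /smlebP ?]].
  by split; apply/smlebP.
exact/smadd_le.
Qed.

Variable phi : mod_type R.

(** The number of submodules of type [phi] containing [u]. *)
Definition nb_over u : rat := \sum_(y <- s | has_typ phi y && smleb u y) 1.

Lemma nb_over_typ u v : typ u = typ v -> nb_over u = nb_over v.
Proof.
move=> /(automorphism_move F_sym)[g gb <-]; have gI := bij_inj gb.
rewrite /nb_over [RHS](sum_smimage F_fin _ _ gb); apply: eq_bigl => y.
by rewrite has_typ_smimage// smleb_smimage.
Qed.

(** The same number as a function of the type of [u]. *)
Definition nb_over_type (t : mod_type R) : rat :=
  nb_over (xget (sm0 F) [set u : submodule F | typ u = t]).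

Lemma nb_over_typeE u : nb_over_type (typ u) = nb_over u.
Proof.
by apply: nb_over_typ; case: xgetP => [r _ //|/(_ u)/(_ erefl)].
Qed.

Variable z0 : submodule F.
Hypothesis z0_sym : symmetric_type (typ z0).

(** The number of submodules of type [phi] containing a module of the type of
    [z0 (+) x / (x :&: w)]. *)
Definition nb_join w x : rat :=
  nb_over_type (typ (z0 * quotmod (restr x w))%type).

Lemma nb_joinE z x : typ z = typ z0 -> tle (typ x) (typ z0) ->
  \sum_(y <- s | has_typ phi y && (smleb z y && smleb x y)) 1 =
  nb_join (smcap x z) x.
Proof.
move=> zz0 xz0; transitivity (nb_over (smadd z x)).
  by apply: eq_bigl => y; rewrite smleb_add.
rewrite -nb_over_typeE typ_smadd ?zz0// /nb_join; congr nb_over_type.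
apply: typ_prod => //; rewrite (_ : restr x (smcap x z) = restr x z)//.
apply: submodP => a; rewrite !in_restr; apply/andP/idP => [[]//|az].
by split=> //; exact: valP.
Qed.

(** The Moebius inverse of [nb_join] in its first argument: summing [nu w x]
    over [w <= u] gives back [nb_join u x]. *)
Definition nu w x : rat := \sum_(v <- s) mu v w * nb_join v x.

Lemma nb_join_nu u x : \sum_(w <- s | smleb w u) nu w x = nb_join u x.
Proof.
rewrite /nu exchange_big /=.
under eq_bigr do rewrite -mulr_suml mu_suml.
rewrite (bigD1_seq u) ?smenum_uniq//= eqxx mul1r big1 ?addr0// => v.
by move=> /negbTE ->; rewrite mul0r.
Qed.

Lemma nu_smimage (g : {linear F -> F}) w x : bijective g ->
  nu (smimage g w) (smimage g x) = nu w x.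
Proof.
move=> gb; have gI := bij_inj gb; rewrite /nu (sum_smimage F_fin _ _ gb).
apply: eq_bigr => v _; congr (_ * _); last first.
  congr nb_over_type; apply: typ_prod => //; exact: typ_quotient_smimage.
have [/smlebP vw|nvw] := boolP (smleb v w); first by rewrite mu_smimage.
by rewrite !mu_out ?smleb_smimage.
Qed.

Lemma sum_sub x (f : submodule F -> rat) :
  \sum_(w <- s | smleb w x) f w = \sum_(k <- smenum x) f (smimage (sminc x) k).
Proof.
have xp := sminc_param x; have [xI _] := xp.
rewrite -big_filter -(perm_big _ (perm_smimage xp F_fin _)) ?big_map//.
exact: finite_submodule_param xI F_fin.
Qed.

Lemma restr_smimage x (k : submodule x) : restr x (smimage (sminc x) k) = k.
Proof.
by rewrite -[RHS](smpreK _ (sminc_param x).1); apply: submodP => a.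
Qed.

(** Duality exchanges the submodules [w] of [x] weighted by [mu w x], which
    depends on the type of [x / w], with the submodules [v] of [x] weighted by
    [mu 0 v]; this turns [nu x x] into an inclusion-exclusion count. *)
Lemma nu_transverse x : duality_axiom (typ x) -> trivial_meet z0 x ->
  nu x x = (nb_transverse phi z0 x)%:R.
Proof.
move=> x_dual z0x; have xI := (sminc_param x).1.
have x_fin := finite_submodule_param xI F_fin.
(* The inclusion-exclusion term of [v], which depends only on its type. *)
pose theta v := mu (sm0 F) v * nb_over_type (typ (z0 * v)%type).
have thetaE v v' : typ v = typ v' -> theta v = theta v'.
  by move=> vv'; rewrite /theta (mu0_typ vv') (typ_prod (erefl (typ z0)) vv').
pose th t := theta (xget (sm0 F) [set u : submodule F | typ u = t]).
have thE v : th (typ v) = theta v.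
  by apply: thetaE; case: xgetP => [r _ //|/(_ v)/(_ erefl)].
(* The term of [w] in [nu x x] is that of a [v] isomorphic to [x / w]. *)
have -> : nu x x = \sum_(k <- smenum x) th (typ (quotmod (k : submodule x))).
  transitivity (\sum_(w <- s | smleb w x) mu w x * nb_join w x).
    rewrite /nu [LHS](bigID (fun w => smleb w x)) /=.
    rewrite [X in _ + X]big1 ?addr0// => w.
    by move=> /mu_out ->; rewrite mul0r.
  rewrite sum_sub; apply: eq_bigr => k _; rewrite /nb_join restr_smimage.
  have [v vE] := duality_sub_quot x_fin x_dual k.
  pose v' := smimage (sminc x) v.
  have v'E : typ v' = typ (quotmod k) by rewrite smimage_param.
  rewrite -v'E thE /theta (typ_prod (erefl (typ z0)) v'E); congr (_ * _).
  apply: mu_quotient => //; last by rewrite restr_smimage.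
  exact: smimage_le (sminc_param x).
rewrite duality_sum//.
transitivity (\sum_(v <- s | smleb v x) theta v).
  rewrite sum_sub; apply: eq_bigr => k _.
  by rewrite -thE smimage_param.
transitivity (\sum_(y <- s | has_typ phi y && smleb z0 y)
    \sum_(v <- s | smleb v (smcap y x)) mu (sm0 F) v).
  under [RHS]eq_bigr do under eq_bigl do rewrite smleb_cap.
  rewrite (exchange_big_dep (fun v => smleb v x)) /=; last first.
    by move=> y v _ /andP[].
  apply: eq_bigr => v /smlebP vx; rewrite /theta -typ_smadd_direct.
    rewrite nb_over_typeE /nb_over mulr_sumr.
    apply: eq_big => y; last by rewrite mulr1.
    by rewrite smleb_add (introT (smlebP _ _) vx) andbT andbA.
  by move=> a az /vx; exact: z0x.
rewrite /nb_transverse card_fset_set_count// -sum1_count natr_sum.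
rewrite [RHS]big_mkcond [LHS]big_mkcond; apply: eq_bigr => y _.
rewrite mu_suml.
case: ifP => [/andP[/has_typP yt /smlebP yz]|nyz]; case: asboolP.
- by move=> [_ _ /trivial_meetP ->]; rewrite eqxx.
- by case: eqP => // /trivial_meetP yx []; split.
- by move=> [/has_typP yt /smlebP yz _]; rewrite yt yz in nyz.
by [].
Qed.

End Counting.

(** * Spans *)

Section Span.
Variables (K : pzRingType) (V : lmodType K).
Implicit Types S T : set V.

Lemma span_incl S u : S u -> Defs.span S u.
Proof.
move=> Su; exists 1%N, (fun=> u), (fun=> 1); split=> //.
by rewrite big_ord1 scale1r.
Qed.

Lemma span0 S : Defs.span S 0.
Proof.
by exists 0%N, (fun=> 0), (fun=> 0); split; [case|rewrite big_ord0].
Qed.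

Lemma spanZ S c u : Defs.span S u -> Defs.span S (c *: u).
Proof.
move=> [n [v [a [vS ->]]]]; exists n, v, (fun i => c * a i); split=> //.
by rewrite scaler_sumr; apply: eq_bigr => i _; rewrite scalerA.
Qed.

Lemma spanD S u w : Defs.span S u -> Defs.span S w -> Defs.span S (u + w).
Proof.
move=> [n [v [a [vS ->]]]] [m [v' [a' [v'S ->]]]].
exists (n + m)%N,
  (fun i => match fintype.split i with inl j => v j | inr j => v' j end),
  (fun i => match fintype.split i with inl j => a j | inr j => a' j end); split.
  by move=> i; case: fintype.split.
rewrite big_split_ord /=; congr (_ + _); apply: eq_bigr => i _.
  by rewrite (unsplitK (inl i)).
by rewrite (unsplitK (inr i)).
Qed.

Lemma span_sum S (I : Type) (r : seq I) (P : pred I) (f : I -> V) :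
  (forall i, P i -> Defs.span S (f i)) -> Defs.span S (\sum_(i <- r | P i) f i).
Proof.
by move=> fS; elim/big_ind: _ => //; [exact: span0|exact: spanD].
Qed.

Lemma span_min S T : (forall u, S u -> Defs.span T u) ->
  forall u, Defs.span S u -> Defs.span T u.
Proof.
move=> ST u [n [v [a [vS ->]]]]; apply: span_sum => i _.
exact/spanZ/ST/vS.
Qed.

End Span.

(** * Products of cellular basis elements *)

Section Operators.
Variables (R : pzRingType) (F : lmodType R).
Hypothesis F_fin : finite_set [set: submodule F].
Implicit Types (u v w x y z : submodule F) (l t : mod_type R).

Let s := smenum F.

(** Extension of a function on the submodules of type [l] by zero. *)
Definition lift l (h : fspace F l) u : rat := oapp h 0 (insub u).

Lemma lift_val l (h : fspace F l) (x : subs F l) : lift h (val x) = h x.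
Proof. by rewrite /lift valK. Qed.

Lemma has_typ_val l (x : subs F l) : has_typ l (val x).
Proof. exact: valP x. Qed.

Lemma fsbig_subs l (P : pred (submodule F)) (h : fspace F l) :
  \sum_(x \in [set x : subs F l | P (val x)]) h x =
  \sum_(u <- s | has_typ l u && P u) lift h u.
Proof.
have fin : finite_set [set x : subs F l | P (val x)].
  apply: (@sub_finite_set _ _ (val @^-1` [set: submodule F])) => //.
  by apply: finite_preimage => // a b _ _; exact: val_inj.
rewrite fsbig_finite//= -[RHS]big_filter.
have E : perm_eq (map val (fset_set [set x : subs F l | P (val x)]))
    [seq u <- s | has_typ l u && P u].
  apply: uniq_perm; rewrite ?filter_uniq ?smenum_uniq//.
    by rewrite map_inj_uniq ?fset_uniq//; exact: val_inj.
  move=> u; rewrite mem_filter mem_smenum// andbT; apply/mapP/andP.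
    by move=> [x]; rewrite in_fset_set// inE /= => Px ->; rewrite has_typ_val.
  move=> [ul Pu]; exists (Sub u ul : subs F l); last by rewrite SubK.
  by rewrite in_fset_set// inE /= .
rewrite -(perm_big _ E) big_map; apply: eq_bigr => x _.
by rewrite lift_val.
Qed.

Variable phi : mod_type R.
Implicit Types h : fspace F phi.

(** The sum of [h] over the submodules of type [phi] containing [w]. *)
Definition upsum h w : rat :=
  \sum_(y <- s | has_typ phi y && smleb w y) lift h y.

Lemma T_prec_lift l h w : has_typ l w ->
  lift (T_prec h : fspace F l) w = upsum h w.
Proof.
move=> wl; rewrite -[w in LHS](SubK (subs F l) wl) lift_val /T_prec.
rewrite /upsum -(@fsbig_subs phi (fun y => smleb w y)); apply: eq_fsbigl.
by apply/seteqP; split=> y /= /smlebP.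
Qed.

Lemma cellE l h (y : subs F phi) :
  cell phi l h y = \sum_(w <- s | has_typ l w && smleb w (val y)) upsum h w.
Proof.
rewrite /cell /= /T_succ.
transitivity
  (\sum_(x \in [set x : subs F l | smleb (val x) (val y)]) T_prec h x).
  by apply: eq_fsbigl; apply/seteqP; split=> x /= /smlebP.
rewrite (fsbig_subs (fun x => smleb x (val y)) (T_prec h)).
by apply: eq_bigr => w /andP[wl _]; exact: T_prec_lift.
Qed.


Lemma cell_lift l h u : has_typ phi u ->
  lift (cell phi l h) u = \sum_(w <- s | has_typ l w && smleb w u) upsum h w.
Proof.
by move=> up; rewrite -[u in LHS](SubK (subs F phi) up) lift_val cellE.
Qed.

Variables (omega kappa : mod_type R) (z0 : submodule F).
Hypotheses (F_sym : symmetric_type (typ F)) (phi_sym : symmetric_type phi)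
  (omega_sym : symmetric_type omega) (ko : tle kappa omega)
  (z0_typ : typ z0 = omega).

Let nu := nu phi z0.

Lemma upsum_cell h z : typ z = omega ->
  upsum (cell phi kappa h) z =
  \sum_(x <- s | has_typ kappa x)
    \sum_(w <- s | smleb w x && smleb w z) upsum h x * nu w x.
Proof.
move=> zo; rewrite /upsum.
under eq_bigr => y /andP[yp _] do rewrite cell_lift//.
rewrite (exchange_big_dep (has_typ kappa)) /=; last by move=> y x _ /andP[].
apply: eq_bigr => x /[dup] xk /has_typP xkE; rewrite -[RHS]mulr_sumr.
have -> : \sum_(w <- s | smleb w x && smleb w z) nu w x =
    nb_join phi z0 (smcap x z) x.
  by rewrite -nb_join_nu//; apply: eq_bigl => w; rewrite smleb_cap.
rewrite -nb_joinE ?z0_typ ?xkE// mulr_sumr.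
by apply: eq_big => [y|y _]; rewrite ?mulr1// xk -andbA.
Qed.

(** The number of submodules of type [omega] between [w] and [y]. *)
Definition nb_between w y : rat :=
  \sum_(z <- s | has_typ omega z && (smleb w z && smleb z y)) 1.

(** The sum of [nu w x] over the submodules [x] of type [kappa] between [w] and
    [y]. *)
Definition nu_between w y : rat :=
  \sum_(x <- s | has_typ kappa x && (smleb w x && smleb x y)) nu w x.

(** The coefficient of the terms at [w] in the product of two cellular basis
    elements; [y] is a submodule of type [phi] containing [w]. *)
Definition cell_coef w y := nb_between w y * nu_between w y.

(** As [phi] and the type of [F] are symmetric, an automorphism of [F] carries
    any pair [w <= y] to any pair [w' <= y'] of the same types. *)
Lemma nb_between_move w y w' y' : smle w y -> smle w' y' -> typ w = typ w' ->
  typ y = phi -> typ y' = phi ->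
  nb_between w y = nb_between w' y' /\ nu_between w y = nu_between w' y'.
Proof.
move=> wy w'y' ww' yp y'p.
have [||g [gb <- <-]] := automorphism_move2 F_sym wy w'y' ww'.
- by rewrite yp.
- by rewrite yp.
have gI := bij_inj gb.
rewrite /nb_between /nu_between.
split; rewrite [RHS](sum_smimage F_fin _ _ gb).
  by apply: eq_bigl => z; rewrite has_typ_smimage// !smleb_smimage.
apply: eq_big => [x|x _]; first by rewrite has_typ_smimage// !smleb_smimage.
by rewrite /nu nu_smimage.
Qed.

Lemma cell_coef_move w y w' y' : smle w y -> smle w' y' -> typ w = typ w' ->
  typ y = phi -> typ y' = phi -> cell_coef w y = cell_coef w' y'.
Proof.
move=> wy w'y' ww' yp y'p; rewrite /cell_coef.
by have [-> ->] := nb_between_move wy w'y' ww' yp y'p.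
Qed.

(** The product evaluated at [h] and [y], after the exchange of sums: [w] is a
    submodule of the intersection of [z] and [x], for [z] of type [omega] in
    [y] and [x] of type [kappa]. *)
Lemma cell_comp_sum h (y : subs F phi) :
  cell phi omega (cell phi kappa h) y =
  \sum_(w <- s | smleb w (val y)) cell_coef w (val y) * upsum h w.
Proof.
rewrite cellE; set y0 := val y; have yp : has_typ phi y0 := has_typ_val y.
under eq_bigr => z /andP[/has_typP zo _] do rewrite upsum_cell//.
transitivity (\sum_(w <- s | smleb w y0)
   nb_between w y0 *
   \sum_(x <- s | has_typ kappa x && smleb w x) upsum h x * nu w x).
  under eq_bigr do rewrite (exchange_big_dep predT)//=.
  rewrite (exchange_big_dep predT)//= [RHS]big_mkcond; apply: eq_bigr => w _.
  transitivity (\sum_(z <- s | has_typ omega z && (smleb w z && smleb z y0))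
      \sum_(x <- s | has_typ kappa x && smleb w x) upsum h x * nu w x).
    rewrite [LHS]big_mkcond [RHS]big_mkcond; apply: eq_bigr => z _.
    case: (has_typ omega z) => //=; case: (smleb z y0); rewrite ?andbF// andbT.
    case: (smleb w z); first by under eq_bigl do rewrite andbT.
    by rewrite big_pred0// => x; rewrite !andbF.
  case: ifP => [_|/negbT nwy].
    by rewrite /nb_between mulr_suml; apply: eq_bigr => z _; rewrite mul1r.
  rewrite big_pred0// => z; apply/negP => /andP[_ /andP[wz zy]].
  by rewrite (smleb_trans wz zy) in nwy.
apply: eq_bigr => w /smlebP wy; rewrite /cell_coef -mulrA; congr (_ * _).
rewrite /upsum; under eq_bigr do rewrite mulr_suml.
rewrite (exchange_big_dep (fun y' => has_typ phi y' && smleb w y')) /=;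
  last first.
  move=> x y' /andP[_ wx] /andP[-> xy']; exact: smleb_trans xy'.
rewrite mulr_sumr; apply: eq_bigr => y' /andP[y'p /smlebP wy'].
rewrite (nb_between_move wy wy' erefl (has_typP _ _ yp) (has_typP _ _ y'p)).2.
rewrite /nu_between mulrC mulr_sumr; apply: eq_bigl => x.
by rewrite y'p /= andbA.
Qed.

Lemma cell_coef_eq0 w y : ~ tle (typ w) kappa -> cell_coef w y = 0.
Proof.
move=> nwk; rewrite /cell_coef /nu_between big_pred0 ?mulr0// => x.
apply/negP => /andP[/has_typP xk /andP[/smlebP /smle_tle wx _]].
by apply: nwk; rewrite -xk.
Qed.

(** The only submodule of type [kappa] containing [w] is [w] itself. *)
Lemma cell_coef_top w y : typ w = kappa -> smle w y ->
  cell_coef w y = nb_between w y * nu w w.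
Proof.
move=> wk wy; rewrite /cell_coef; congr (_ * _).
rewrite /nu_between -big_filter (_ : [seq _ <- _ | _] = [:: w]) ?big_seq1//.
apply/perm_small_eq => //.
apply: uniq_perm; rewrite ?filter_uniq ?smenum_uniq//.
move=> x; rewrite mem_filter mem_smenum// andbT inE.
apply/andP/eqP => [[/has_typP xk /andP[/smlebP wx _]]|->].
  by apply/esym/(typ_le_eq F_fin F_sym) => //; rewrite wk.
by split; [apply/has_typP|apply/andP; split; apply/smlebP].
Qed.

(** Computing the coefficients on representatives inside a fixed submodule
    [y0] of type [phi] turns [cell_comp_sum] into a combination of cellular
    basis elements. *)
Lemma cell_comp y0 w0 : typ y0 = phi -> smle w0 y0 -> typ w0 = kappa ->
  hecke_lt phi kappa (cell phi omega \o cell phi kappa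
    - (nb_between w0 y0 * nu w0 w0) *: (cell phi kappa : operator F phi)).
Proof.
move=> y0p w0y0 w0k.
pose rep t : submodule F :=
  xget (sm0 F) [set w : submodule F | typ w = t /\ smle w y0].
have repP t : tle t phi -> typ (rep t) = t /\ smle (rep t) y0.
  move=> tp; rewrite /rep; case: xgetP => [r _ //|].
  have [w wy0 wt] : exists2 w, smle w y0 & typ w = t.
    by apply: tle_sub; rewrite y0p.
  by move=> /(_ w) H; case: H.
pose L := [seq r : submodule F <- s | (rep (typ r) == r) && smleb r y0].
have repL t : tle t phi -> rep t \in L.
  move=> /repP[tE ty0]; rewrite mem_filter mem_smenum// andbT tE eqxx.
  exact/smlebP.
(* [L] contains exactly one submodule of [y0] for each type. *)
have LE : cell phi omega \o cell phi kappa =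
    \sum_(r <- L) cell_coef r y0 *: (cell phi (typ r) : operator F phi).
  apply/funext => h; apply/funext => y; rewrite /= cell_comp_sum.
  have sumE (I : Type) (r : seq I) (f : I -> operator F phi) :
      (\sum_(i <- r) f i) h y = \sum_(i <- r) f i h y.
    by elim/big_rec2: _ => // i a b _ <-.
  rewrite sumE; have yp := has_typP _ _ (has_typ_val y).
  transitivity (\sum_(r <- L)
      \sum_(w <- s | has_typ (typ r) w && smleb w (val y))
        cell_coef r y0 * upsum h w); last first.
    by apply: eq_bigr => r _; rewrite -mulr_sumr -cellE.
  rewrite (exchange_big_dep (fun w => smleb w (val y))) /=; last first.
    by move=> r w _ /andP[].
  apply: eq_bigr => w /[dup] wyb /smlebP wy.
  have wp : tle (typ w) phi by rewrite -yp; exact: smle_tle.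
  have [rE ry0] := repP _ wp.
  rewrite (@bigD1_seq_cond _ _ L _ _ (rep (typ w))) ?filter_uniq ?smenum_uniq
    ?repL//=; last first.
    by rewrite wyb andbT; apply/has_typP; rewrite rE.
  rewrite (cell_coef_move wy ry0 (esym rE) yp y0p) -[LHS]addr0; congr (_ + _).
  rewrite big_seq_cond big1// => r /andP[]; rewrite mem_filter.
  move=> /andP[/andP[/eqP rr _] _] /andP[/andP[/has_typP wr _]].
  by rewrite wr rr eqxx.
have kp : tle kappa phi by rewrite -w0k -y0p; exact: smle_tle.
have [rE ry0] := repP _ kp.
rewrite LE (@bigD1_seq_cond _ _ L _ _ (rep kappa)) ?filter_uniq ?smenum_uniq
  ?repL//=.
rewrite rE (cell_coef_move ry0 w0y0 _ y0p y0p) ?rE// cell_coef_top//.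
have addrKC (a b : operator F phi) : a + b - a = b by rewrite addrC addKr.
rewrite addrKC.
rewrite big_seq_cond; apply: span_sum => r /andP[].
rewrite mem_filter => /andP[/andP[/eqP rr _] _] nrk.
have [rk|/cell_coef_eq0 ->] := pselect (tle (typ r) kappa); last first.
  by rewrite scale0r; exact: span0.
apply/spanZ/span_incl; exists (typ r) => //; split=> // E.
by rewrite -rr E eqxx in nrk.
Qed.

End Operators.

(** * Cellular basis elements modulo lower terms *)

Section Idempotents.
Variables (R : pzRingType) (F : lmodType R).
Hypotheses (F_fin : finite_set [set: submodule F])
  (F_sym : symmetric_type (typ F)).
Variable phi : mod_type R.

(** Comparable submodules of type [phi] are equal. *)
Lemma cell_phi_id : cell phi phi = id :> operator F phi.
Proof.
apply/funext => h; apply/funext => y; rewrite cellE//.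
have yp : typ (val y) = phi := has_typP _ _ (has_typ_val y).
have only_y (P : rel (submodule F)) (g : submodule F -> rat) :
    (forall w, P w (val y) -> typ w = phi -> w = val y) -> P (val y) (val y) ->
    \sum_(w <- smenum F | has_typ phi w && P w (val y)) g w = g (val y).
  move=> Py Pyy.
  rewrite (@bigD1_seq_cond _ _ _ _ _ (val y)) ?smenum_uniq ?mem_smenum//.
    rewrite big1 ?addr0// => w /andP[/andP[/has_typP wp wy]].
    by rewrite (Py w wy wp) eqxx.
  by rewrite has_typ_val.
have yy : smleb (val y) (val y) by exact/smlebP.
rewrite (only_y (@smleb R F))//.
  rewrite /upsum (only_y (fun w z => smleb z w))// ?lift_val//.
  by move=> w /smlebP yw wp; rewrite (typ_le_eq F_fin F_sym yw)// yp wp.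
by move=> w /smlebP wy wp; rewrite (typ_le_eq F_fin F_sym wy)// yp wp.
Qed.

Lemma comp_suml (I : Type) (r : seq I) (f : I -> operator F phi)
    (c : operator F phi) :
  (\sum_(i <- r) f i) \o c = \sum_(i <- r) (f i \o c).
Proof.
by elim/big_rec2: _ => // i a b _ <-.
Qed.

Lemma comp_linear_sumr (e : operator F phi) n (a : 'I_n -> rat)
    (v : 'I_n -> operator F phi) : linear e ->
  e \o (\sum_i a i *: v i) = \sum_i a i *: (e \o v i : operator F phi).
Proof.
move=> el; elim/big_rec2: _ => [|i b c _ <-].
  apply/funext => h /=; exact: (linear0 (lin_of el)).
by apply/funext => h /=; exact: el.
Qed.

(** An idempotent that lowers every layer of the cellular filtration
    annihilates the whole filtration, which contains the identity [c_phi]. *)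
Lemma lowering_idempotent_eq0 (e : operator F phi) :
  tle phi (typ F) -> linear e -> e \o e = e ->
  (forall l, tle l phi ->
     forall a, hecke_le phi l a -> hecke_lt phi l (e \o a)) ->
  e = 0.
Proof.
move=> /typ_tle[y0 y0p] el ee low.
(* Induction on the number of submodules of [u]: applying [e] once more to
   [e o c_l] gives a combination of [e o c_l'] with [l' < l]. *)
have vanish (u : submodule F) : tle (typ u) phi -> e \o cell phi (typ u) = 0.
  have [n] := ubnP (count (fun d => smleb d u) (smenum F)).
  elim: n u => // n IH u un up.
  have [|m [v [a [vS E]]]] := low _ up (cell phi (typ u)).
    by apply: span_incl; exists (typ u) => //; exact: tle_refl.
  have -> : e \o cell phi (typ u) = e \o (e \o cell phi (typ u)).
    by rewrite -[in LHS]ee.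
  rewrite E comp_linear_sumr// big1// => i _.
  have [l [lu nlu] ->] := vS i; have [w wu wl] := tle_sub lu.
  rewrite -wl IH ?scaler0//; last by rewrite wl; exact: tle_trans up.
  move: un; rewrite ltnS; apply: leq_trans; apply: rank_lt.
  - exact: mem_smenum.
  - exact: smleb_refl.
  - exact: smleb_anti.
  - exact: smleb_trans.
  - exact/smlebP.
  - by apply/eqP => wE; apply: nlu; rewrite -wl wE.
have := vanish y0; rewrite y0p cell_phi_id; apply; exact: tle_refl.
Qed.

Lemma cell_notin_lt (k : mod_type R) (e : operator F phi) :
  tle phi (typ F) -> tle k phi -> cell_idempotent k e ->
  ~ hecke_lt phi k (cell phi k : operator F phi).
Proof.
move=> pF kp [[[el _] ee e0 _] ek el'] ck; apply: e0.
apply: lowering_idempotent_eq0 => // l lp a.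
have [->{l lp}|lk] := pselect (l = k); last exact: el'.
move=> ak; have akl : hecke_lt phi k a.
  move: a ak; apply: span_min => _ [l lk ->].
  have [->//|nlk] := pselect (l = k).
  by apply: span_incl; exists l.
have -> : e \o a = (e \o a - a) + a by rewrite subrK.
by apply: spanD => //; exact: ek.
Qed.

End Idempotents.

Section Expansion.
Variables (R : pzRingType) (F : lmodType R).
Hypothesis F_fin : finite_set [set: submodule F].
Variables (phi omega kappa : mod_type R).
Hypotheses (ko : tle kappa omega) (op : tle omega phi).

Lemma sub_type_finite (P : set (Defs.sub_type F)) : finite_set P.
Proof.
apply: (@sub_finite_set _ _
  ((fun k : Defs.sub_type F => repr k) @^-1` [set: submodule F])) => //.
by apply: finite_preimage => // a b _ _; exact: (can_inj reprK).
Qed.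

Lemma type_of_pi (x : submodule F) :
  type_of (\pi_(Defs.sub_type F)%qT x) = typ x.
Proof.
rewrite /type_of.
have : (repr (\pi_(Defs.sub_type F) x) = x %[mod (Defs.sub_type F)])%qT.
  exact: reprK.
by move=> /eqmodP /asboolP.
Qed.

Lemma type_of_inj : injective (@type_of R F).
Proof.
move=> a b ab; rewrite -[a]reprK -[b]reprK.
by apply/eqmodP/asboolP.
Qed.

(** Modulo lower terms, [c_omega] acts on [c_kappa] by the coefficient of
    [e_kappa] in the expansion of [c_omega]. *)
Lemma expansion_comp (x : submodule F) (e : mod_type R -> operator F phi) A :
  typ x = kappa ->
  (forall l, tle l phi -> cell_idempotent l (e l)) -> cell_expansion e A ->
  hecke_lt phi kappa (cell phi omega \o cell phi kappa
    - A omega kappa *: (cell phi kappa : operator F phi)).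
Proof.
move=> xk he hA; rewrite hA// fsbig_finite; last exact: sub_type_finite.
have kS : \pi_(Defs.sub_type F)%qT x \in
    fset_set [set k : Defs.sub_type F | tle (type_of k) omega].
  rewrite in_fset_set ?inE /=; last exact: sub_type_finite.
  by rewrite type_of_pi xk.
have kcell : hecke_le phi kappa (cell phi kappa : operator F phi).
  by apply: span_incl; exists kappa => //; exact: tle_refl.
have kp := tle_trans ko op.
rewrite comp_suml (bigD1_seq _ kS) ?fset_uniq//= type_of_pi xk.
set S := \sum_(_ <- _ | _) _.
set c : operator F phi := cell phi kappa.
have -> : (A omega kappa *: e kappa \o c : operator F phi) + S
    - A omega kappa *: c =
   A omega kappa *: (e kappa \o c - c : operator F phi) + S.
  by rewrite scalerBr addrAC.
apply: spanD; first by apply: spanZ; have [_ H _] := he _ kp; exact: H.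
rewrite /S big_seq_cond; apply: span_sum => l /andP[].
rewrite in_fset_set ?inE /=; last exact: sub_type_finite.
move=> lo nlk; have lp := tle_trans lo op.
have -> : (A omega (type_of l) *: e (type_of l)) \o c =
  A omega (type_of l) *: (e (type_of l) \o c : operator F phi) by [].
apply: spanZ; have [_ _ H] := he _ lp; apply: H => // E.
move/eqP: nlk; apply; apply: type_of_inj.
by rewrite type_of_pi xk E.
Qed.

End Expansion.

(** [nb_above] counts inside the module [f]; the embedding [i] carries the count
    to the submodules of [F] contained in the image of [f]. *)
Lemma nb_above_between (R : pzRingType) (F f : lmodType R) (omega : mod_type R)
    (i : {linear f -> F}) (y : submodule F) (x : submodule f) :
  finite_set [set: submodule F] -> param i y ->
  nb_between omega (smimage i x) y = (nb_above omega x)%:R.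
Proof.
move=> F_fin iy; have [iI _] := iy.
have f_fin := finite_submodule_param iI F_fin.
rewrite /nb_above card_fset_set_count// -sum1_count natr_sum /nb_between.
transitivity (\sum_(z <- [seq v <- smenum F | smleb v y]
    | has_typ omega z && smleb (smimage i x) z) (1 : rat)).
  by rewrite big_filter_cond; apply: eq_bigl => z; rewrite andbA andbC.
rewrite -(perm_big _ (perm_smimage iy F_fin f_fin)) big_map.
apply: eq_bigl => z; rewrite /has_typ smimage_param//.
apply/andP/asboolP => [[/asboolP zo /smlebP/(smimage_mono _ _ iI) xz]//|].
move=> [zo xz].
by split; [apply/asboolP|apply/smlebP/smimage_mono].
Qed.

Theorem theorem6 (R : pzRingType) (Phi phi omega kappa : mod_type R)
    (hcouple_phi : symmetric_couple Phi phi)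
    (F : lmodType R) (hF : typ F = Phi) (hFfg : fin_generated F)
    (hFfin : finite_set [set: submodule F])
    (hko : tle kappa omega) (hop : tle omega phi)
    (hcouple_omega : symmetric_couple Phi omega)
    (hdual : duality_axiom kappa)
    (e : mod_type R -> operator F phi)
    (he : forall l, tle l phi -> cell_idempotent l (e l))
    (A : mod_type R -> mod_type R -> rat)
    (hA : cell_expansion e A)
    (f : lmodType R) (hf : typ f = phi)
    (x : submodule f) (hx : typ x = kappa)
    (x_omega x_kappa : submodule F)
    (hxo : typ x_omega = omega) (hxk : typ x_kappa = kappa)
    (hmeet : trivial_meet x_omega x_kappa) :
  A omega kappa
    = (nb_above omega x)%:R * (nb_transverse phi x_omega x_kappa)%:R.
Proof.
have [F_sym phi_sym pF _] := hcouple_phi.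
have [_ omega_sym _ _] := hcouple_omega.
rewrite -hF in F_sym pF.
have [y0 y0p] := typ_tle pF.
have [i iy0] : exists i : {linear f -> F}, param i y0.
  by apply: typ_param; rewrite hf y0p.
pose w0 := smimage i x; have [iI _] := iy0.
have w0k : typ w0 = kappa by rewrite smimage_param.
have w0y0 : smle w0 y0 := smimage_le iy0.
have key1 := cell_comp hFfin F_sym phi_sym omega_sym hko hxo y0p w0y0 w0k.
have key2 := expansion_comp hFfin hko hop hxk he hA.
rewrite nb_above_between// in key1.
have nuE : nu phi x_omega w0 w0 = (nb_transverse phi x_omega x_kappa)%:R.
  have [g gb <-] : exists2 g : {linear F -> F},
      bijective g & smimage g x_kappa = w0.
    by apply: automorphism_move; rewrite // w0k.
  by rewrite nu_smimage// nu_transverse ?hxk.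
rewrite nuE in key1.
apply: contrapT => /eqP; rewrite -subr_eq0 => neq.
have kp := tle_trans hko hop.
apply: (cell_notin_lt hFfin F_sym pF kp (he _ kp)).
have cancel_scale (V : lmodType rat) (u v : V) (a b : rat) : a - b != 0 ->
    v = (a - b)^-1 *: ((u - b *: v) - (u - a *: v)).
  move=> ab; rewrite opprB [X in _ *: X]addrC subrKA -scalerBl scalerA mulVf//.
  by rewrite scale1r.
rewrite [X in hecke_lt _ _ X](cancel_scale (operator F phi)
  (cell phi omega \o cell phi kappa) _ _ _ neq).
by apply/spanZ/spanD => //; rewrite -scaleN1r; exact: spanZ.
Qed.
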